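(* For all finite filtered spaces $\mathbf{X},\mathbf{Y}\in\mathcal{F}$ and all integers $k\ge0$ one has $$\sup_{T\in\mathcal{T}^{\mathrm{opt}}(\mathbf{X},\mathbf{Y})}\mathrm{L}_{\mathcal{D}}\big(\mathrm{D}_k(\gamma_T)\big)\leq d_{\mathcal{F}}(\mathbf{X},\mathbf{Y}),$$ where $\mathrm{D}_k(\gamma_T)$ denotes the curve $[0,1]\ni t\mapsto\mathrm{D}_k(\gamma_T(t))$ of persistence diagrams.
   Context: Filtered spaces. For a finite set $X$, $\mathrm{pow}(X)$ denotes the set of nonempty subsets of $X$. A (finite) filtered space is a pair $\mathbf{X}=(X,F_X)$ where $X$ is a nonempty finite set and $F_X:\mathrm{pow}(X)\to\mathbb{R}$ is monotone, i.e. $F_X(\sigma)\ge F_X(\tau)$ whenever $\sigma\supseteq\tau$. $\mathcal{F}$ denotes the collection of all finite filtered spaces. The distance $d_{\mathcal{F}}$. A tripod between $\mathbf{X}=(X,F_X)$ and $\mathbf{Y}=(Y,F_Y)$ is a triple $(Z,\varphi_X,\varphi_Y)$ with $Z$ a finite set and $\varphi_X:Z\to X$, $\varphi_Y:Z\to Y$ surjective maps. The pullback filtrations on $Z$ are $\varphi_X^*F_X(\tau):=F_X(\varphi_X(\tau))$ and $\varphi_Y^*F_Y(\tau):=F_Y(\varphi_Y(\tau))$ for $\tau\in\mathrm{pow}(Z)$. Define $$d_{\mathcal{F}}(\mathbf{X},\mathbf{Y}):=\inf_{(Z,\varphi_X,\varphi_Y)}\ \max_{\tau\in\mathrm{pow}(Z)}\big|\varphi_X^*F_X(\tau)-\varphi_Y^*F_Y(\tau)\big|,$$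 the infimum being over all tripods. Minimizing tripods and the curves $\gamma_T$. $\mathcal{T}^{\mathrm{opt}}(\mathbf{X},\mathbf{Y})$ is the collection of all tripods $(Z,\varphi_X,\varphi_Y)$ between $\mathbf{X}$ and $\mathbf{Y}$ with $\max_{\tau\in\mathrm{pow}(Z)}|\varphi_X^*F_X(\tau)-\varphi_Y^*F_Y(\tau)|=d_{\mathcal{F}}(\mathbf{X},\mathbf{Y})$. For $T=(Z,\varphi_X,\varphi_Y)\in\mathcal{T}^{\mathrm{opt}}(\mathbf{X},\mathbf{Y})$, the curve $\gamma_T:[0,1]\to\mathcal{F}$ is $\gamma_T(t):=(Z,F_t)$ with $F_t:=(1-t)\cdot\varphi_X^*F_X+t\cdot\varphi_Y^*F_Y$. Persistence diagrams. Fix a field $\mathbb{F}$; all homology is (unreduced) simplicial homology with coefficients in $\mathbb{F}$. For $\mathbf{X}=(X,F_X)\in\mathcal{F}$ and $\varepsilon\in\mathbb{R}$, let $L_\varepsilon(\mathbf{X}):=\{\sigma\in\mathrm{pow}(X): F_X(\sigma)\le\varepsilon\}$, a finite simplicial complex (possibly empty). For an integer $k\ge0$, the inclusions $L_\varepsilon(\mathbf{X})\subseteq L_{\varepsilon'}(\mathbf{X})$, $\varepsilon\le\varepsilon'$, induce the persistence vector space $\mathbb{V}_k(\mathbf{X})=\{H_k(L_\varepsilon(\mathbf{X}))\to H_k(L_{\varepsilon'}(\mathbf{X}))\}_{\varepsilon\le\varepsilon'}$. It is classified up to isomorphism by a finite multiset of intervals $[b,d)$ with $b\in\mathbb{R}$,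 $b<d\le\infty$ (the intervals in its decomposition into interval modules). $\mathrm{D}_k(\mathbf{X})$ is the corresponding finite multiset of points $(b,d)$, the $k$-th persistence diagram. $\mathcal{D}$ denotes the collection of finite persistence diagrams. Bottleneck distance. For $P=(x_P,y_P)$ with $x_P\le y_P$, put $\mathrm{pers}(P):=y_P-x_P$ (equal to $\infty$ if $y_P=\infty$). In $\|P-Q\|_\infty$ use the conventions $|\infty-\infty|=0$ and $|\infty-a|=\infty$ for $a\in\mathbb{R}$; a maximum over the empty set is $0$. For finite persistence diagrams $D_1=\{P_\alpha\}_{\alpha\in A_1}$, $D_2=\{Q_\alpha\}_{\alpha\in A_2}$, subsets $B_i\subseteq A_i$ with $|B_1|=|B_2|$ and a bijection $\varphi:B_1\to B_2$, let $$J(\varphi):=\max\Big(\max_{\beta\in B_1}\|P_\beta-Q_{\varphi(\beta)}\|_\infty,\ \max_{\alpha\in A_1\setminus B_1}\tfrac12\mathrm{pers}(P_\alpha),\ \max_{\alpha\in A_2\setminus B_2}\tfrac12\mathrm{pers}(Q_\alpha)\Big),$$ and $d_{\mathcal{D}}(D_1,D_2):=\min_{(B_1,B_2,\varphi)}J(\varphi)$ over all such triples. Length. For a curve $\alpha:[0,1]\to\mathcal{D}$, $$\mathrm{L}_{\mathcal{D}}(\alpha):=\sup\Big\{\sum_{i=0}^{n-1}d_{\mathcal{D}}(\alpha(t_i),\alpha(t_{i+1}))\ :\ n\ge1,\ 0=t_0<t_1<\cdots<t_n=1\Big\}.$$ *)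

(* Defs.v *)
From HB Require Import structures.
From mathcomp Require Import all_boot all_order all_algebra.
From mathcomp Require Import all_classical all_reals all_analysis.

Set Implicit Arguments.
Unset Strict Implicit.
Unset Printing Implicit Defensive.

Import Order.TTheory GRing.Theory Num.Theory.

Local Open Scope ring_scope.

Definition pow (X : finType) := {s : {set X} | s != finset.set0}.
HB.instance Definition _ (X : finType) := SubFinite.on (pow X).

Fact pow_image_subproof (Z X : finType) (f : Z -> X) (s : pow Z) :
  f @: val s != finset.set0.
Proof.
case/set0Pn: (valP s) => z zs; apply/set0Pn; exists (f z).
exact: imset_f.
Qed.

Definition pow_image (Z X : finType) (f : Z -> X) (s : pow Z) : pow X :=
  Sub (f @: val s) (pow_image_subproof f s).

Record filtered_space (R : realType) := FilteredSpace {
  carrier :> finType;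
  carrier_gt0 : (0 < #|carrier|)%N;
  filt : pow carrier -> R;
  filt_mono : forall s t : pow carrier, val t \subset val s -> filt t <= filt s
}.

Record tripod (R : realType) (X Y : filtered_space R) := Tripod {
  apex :> finType;
  projX : apex -> X;
  projY : apex -> Y;
  projX_surj : forall x, exists z, projX z = x;
  projY_surj : forall y, exists z, projY z = y
}.
Arguments projX {R X Y} t _.
Arguments projY {R X Y} t _.

Definition pullback (R : realType) (X : filtered_space R) (Z : finType)
    (f : Z -> X) (s : pow Z) : R :=
  filt (pow_image f s).

(* The terms are nonnegative, so starting the maximum at 0 is harmless. *)
Definition distortion (R : realType) (X Y : filtered_space R) (T : tripod X Y)
    : R :=
  \big[Num.max/0]_(s : pow T)
     `|pullback (projX T) s - pullback (projY T) s|.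

Definition dF (R : realType) (X Y : filtered_space R) : R :=
  inf [set r | exists T : tripod X Y, r = distortion T]%classic.

(* A plain predicate, as [set] lives in a universe too small for [tripod X Y]. *)
Definition Topt (R : realType) (X Y : filtered_space R) (T : tripod X Y)
    : Prop :=
  distortion T = dF X Y.

Section Geodesic.
Variables (R : realType) (X Y : filtered_space R) (T : tripod X Y).

Fact apex_gt0 : (0 < #|T|)%N.
Proof.
have /card_gt0P[x _] := carrier_gt0 X.
by have [z _] := projX_surj T x; apply/card_gt0P; exists z.
Qed.

Definition filt_interp (t : {i01 R}) (s : pow T) : R :=
  (1 - t%:num) * pullback (projX T) s + t%:num * pullback (projY T) s.

Fact filt_interp_mono (t : {i01 R}) (s u : pow T) :
  val u \subset val s -> filt_interp t u <= filt_interp t s.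
Proof.
move=> us; rewrite /filt_interp /pullback.
have t0 : 0 <= t%:num by [].
have t1 : 0 <= 1 - t%:num by rewrite subr_ge0.
by apply: lerD; apply: ler_wpM2l => //; apply: filt_mono; apply: imsetS.
Qed.

Definition gammaT (t : {i01 R}) : filtered_space R :=
  FilteredSpace apex_gt0 (filt_interp_mono t).

End Geodesic.

Record persistence_space (R : realType) (F : fieldType) := PersistenceSpace {
  pvs_at :> R -> lmodType F;
  pvs_map : forall s t : R, s <= t -> {linear pvs_at s -> pvs_at t};
  pvs_map_id : forall (s : R) (h : s <= s) v, pvs_map h v = v;
  pvs_map_comp : forall (r s t : R) (rs : r <= s) (st : s <= t) (rt : r <= t) v,
    pvs_map st (pvs_map rs v) = pvs_map rt v
}.

Definition pvs_iso (R : realType) (F : fieldType)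
    (V W : persistence_space R F) : Prop :=
  exists f : forall t : R, {linear V t -> W t},
    (forall t, bijective (f t)) /\
    (forall (s t : R) (st : s <= t) (v : V s),
       f t (pvs_map V st v) = pvs_map W st (f s v)).

Section ZeroAndSum.
Variables (R : realType) (F : fieldType).

Definition pvs_zero : persistence_space R F :=
  @PersistenceSpace R F (fun=> 'rV[F]_0) (fun _ _ _ => idfun)
    (fun _ _ _ => erefl) (fun _ _ _ _ _ _ _ => erefl).

Variables V W : persistence_space R F.

Definition pvs_sum_map (s t : R) (st : s <= t) (v : (V s * W s)%type)
    : (V t * W t)%type :=
  (pvs_map V st v.1, pvs_map W st v.2).

Fact pvs_sum_map_linear s t (st : s <= t) : linear (pvs_sum_map st).
Proof.
by move=> a [v w] [v' w']; rewrite /pvs_sum_map /= !linearP.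
Qed.

HB.instance Definition _ s t (st : s <= t) :=
  GRing.isLinear.Build F (V s * W s)%type (V t * W t)%type _
    (pvs_sum_map st) (pvs_sum_map_linear st).

Fact pvs_sum_map_id s (h : s <= s) v : pvs_sum_map h v = v.
Proof. by case: v => v w; rewrite /pvs_sum_map /= !pvs_map_id. Qed.

Fact pvs_sum_map_comp r s t (rs : r <= s) (st : s <= t) (rt : r <= t) v :
  pvs_sum_map st (pvs_sum_map rs v) = pvs_sum_map rt v.
Proof. by rewrite /pvs_sum_map /= !(pvs_map_comp rs st rt). Qed.

Definition pvs_sum : persistence_space R F :=
  @PersistenceSpace R F (fun t => (V t * W t)%type)
    (fun s t st => pvs_sum_map st) pvs_sum_map_id pvs_sum_map_comp.

End ZeroAndSum.

(* A finite multiset of points (b, d), listed in an arbitrary order. *)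
Notation diagram R := (seq (R * \bar R)).

Section Interval.
Variables (R : realType) (F : fieldType) (p : R * \bar R).

Definition in_interval (t : R) : bool := (p.1 <= t) && (t%:E < p.2)%E.

(* The space at t is 'rV_1 or 'rV_0, according to whether t lies in [b, d);
   pid_mx 1 is the identity between two copies of 'rV_1, and 0 otherwise. *)
Definition interval_map (s t : R) : 'M[F]_(in_interval s, in_interval t) :=
  pid_mx 1.

Fact interval_map_id s (v : 'rV[F]_(in_interval s)) :
  v *m interval_map s s = v.
Proof.
rewrite /interval_map.
case: (in_interval s) v => v; last by rewrite [v]thinmx0 mul0mx.
by rewrite pid_mx_1 mulmx1.
Qed.

Fact interval_map_comp r s t (v : 'rV[F]_(in_interval r)) :
  r <= s -> s <= t ->
  v *m interval_map r s *m interval_map s t = v *m interval_map r t.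
Proof.
move=> rs st; rewrite -mulmxA /interval_map mul_pid_mx.
case: (boolP (in_interval s)) => [_|s_out]; first by [].
have: ~~ (in_interval r && in_interval t).
  apply: contra s_out; rewrite /in_interval.
  case/andP=> /andP[br _] /andP[_ td]; rewrite (le_trans br rs) /=.
  by rewrite (le_lt_trans _ td) // lee_fin.
rewrite negb_and => /orP[] /negbTE out; move: v; rewrite out => v.
  by rewrite [v]thinmx0 !mul0mx.
by rewrite [LHS]thinmx0 [RHS]thinmx0.
Qed.

Definition interval_module : persistence_space R F :=
  @PersistenceSpace R F (fun t => 'rV[F]_(in_interval t))
    (fun s t _ => mulmxr (interval_map s t))
    (fun s _ v => interval_map_id v)
    (fun r s t rs st _ v => interval_map_comp v rs st).

End Interval.

Definition barcode_module (R : realType) (F : fieldType) (D : diagram R)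
    : persistence_space R F :=
  foldr (fun p V => pvs_sum (interval_module F p) V) (pvs_zero R F) D.

Definition is_barcode (R : realType) (F : fieldType)
    (V : persistence_space R F) (D : diagram R) : Prop :=
  (forall p, p \in D -> (p.1%:E < p.2)%E) /\ pvs_iso V (barcode_module F D).

(* By the structure theorem, the persistent homology of a finite filtered space
   has a barcode, unique up to the order of its points; [::] is a junk value for
   modules without a finite barcode of this form. *)
Definition barcode (R : realType) (F : fieldType)
    (V : persistence_space R F) : diagram R :=
  xget [::] [set D | is_barcode V D]%classic.

Section Quotient.
Variables (F : fieldType) (V : vectType F) (U : {vspace V}).

Definition eqmod (x y : V) : bool := x - y \in U.

Fact eqmod_refl : reflexive eqmod.
Proof. by move=> x; rewrite /eqmod subrr mem0v. Qed.

Fact eqmod_sym : symmetric eqmod.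
Proof. by move=> x y; rewrite /eqmod -opprB memvN. Qed.

Fact eqmod_trans : transitive eqmod.
Proof.
by move=> y x z xy yz; rewrite /eqmod -[x](subrK y) -addrA memvD.
Qed.

Canonical eqmod_equiv := EquivRel eqmod eqmod_refl eqmod_sym eqmod_trans.

Definition vquot := {eq_quot eqmod}%qT.

HB.instance Definition _ := Choice.on vquot.
HB.instance Definition _ : EqQuotient V eqmod vquot := EqQuotient.on vquot.

Lemma vquotP (x y : V) :
  reflect (\pi_vquot%qT x = \pi_vquot%qT y) (x - y \in U).
Proof. exact: (@eqquotP _ _ vquot x y). Qed.

Lemma vquotW (P : vquot -> Prop) :
  (forall x, P (\pi_vquot%qT x)) -> forall a, P a.
Proof. by move=> Px a; rewrite -[a]reprK. Qed.

Let repr_pi x : repr (\pi_vquot%qT x) - x \in U.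
Proof. by apply/vquotP; rewrite reprK. Qed.

Definition vquot_zero : vquot := \pi_vquot%qT 0.
Definition vquot_opp (a : vquot) : vquot := \pi_vquot%qT (- repr a).
Definition vquot_add (a b : vquot) : vquot := \pi_vquot%qT (repr a + repr b).
Definition vquot_scale (k : F) (a : vquot) : vquot :=
  \pi_vquot%qT (k *: repr a).

Fact pi_opp x : vquot_opp (\pi_vquot%qT x) = \pi_vquot%qT (- x).
Proof. by apply/vquotP; rewrite -opprD memvN repr_pi. Qed.

Fact pi_add x y :
  vquot_add (\pi_vquot%qT x) (\pi_vquot%qT y) = \pi_vquot%qT (x + y).
Proof. by apply/vquotP; rewrite opprD addrACA memvD // repr_pi. Qed.

Fact pi_scale k x : vquot_scale k (\pi_vquot%qT x) = \pi_vquot%qT (k *: x).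
Proof. by apply/vquotP; rewrite -scalerBr memvZ // repr_pi. Qed.

Fact vquot_addA : associative vquot_add.
Proof.
move=> a b c; elim/vquotW: a => x; elim/vquotW: b => y; elim/vquotW: c => z.
by rewrite !pi_add addrA.
Qed.

Fact vquot_addC : commutative vquot_add.
Proof.
by move=> a b; elim/vquotW: a => x; elim/vquotW: b => y; rewrite !pi_add addrC.
Qed.

Fact vquot_add0 : left_id vquot_zero vquot_add.
Proof. by move=> a; elim/vquotW: a => x; rewrite pi_add add0r. Qed.

Fact vquot_addN : left_inverse vquot_zero vquot_opp vquot_add.
Proof. by move=> a; elim/vquotW: a => x; rewrite pi_opp pi_add addNr. Qed.

HB.instance Definition _ := GRing.isZmodule.Build vquot
  vquot_addA vquot_addC vquot_add0 vquot_addN.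

Fact vquot_scaleA k l a :
  vquot_scale k (vquot_scale l a) = vquot_scale (k * l) a.
Proof. by elim/vquotW: a => x; rewrite !pi_scale scalerA. Qed.

Fact vquot_scale1 : left_id 1 vquot_scale.
Proof. by move=> a; elim/vquotW: a => x; rewrite pi_scale scale1r. Qed.

Fact vquot_scaleDr : right_distributive vquot_scale +%R.
Proof.
move=> k a b; elim/vquotW: a => x; elim/vquotW: b => y.
by rewrite [_ + _]pi_add !pi_scale [RHS]pi_add scalerDr.
Qed.

Fact vquot_scaleDl a : {morph vquot_scale^~ a : k l / k + l}.
Proof.
by elim/vquotW: a => x k l; rewrite !pi_scale [RHS]pi_add scalerDl.
Qed.

HB.instance Definition _ := GRing.Zmodule_isLmodule.Build F vquot
  vquot_scaleA vquot_scale1 vquot_scaleDr vquot_scaleDl.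

Definition vproj (x : V) : vquot := \pi_vquot%qT x.

Fact vproj_linear : linear vproj.
Proof. by move=> k x y; rewrite /vproj -pi_add -pi_scale. Qed.

HB.instance Definition _ := GRing.isLinear.Build F V vquot _ vproj vproj_linear.

Lemma vprojP (x y : V) : reflect (vproj x = vproj y) (x - y \in U).
Proof. exact: vquotP. Qed.

Lemma vproj_repr (a : vquot) : vproj (repr a) = a.
Proof. exact: reprK. Qed.

End Quotient.

(* F^o so that chains inherit a vector space structure over F. *)
Notation chain F X := {ffun pow X -> F^o}.

Section Homology.
Variables (F : fieldType) (X : finType).
Implicit Types (L : {set pow X}) (k : nat).

(* The sign of the face opposite to v, each simplex being oriented by the
   enumeration order of X. *)
Definition face_sign (u : {set X}) (v : X) : F :=
  (-1) ^+ #|[set x in u | (enum_rank x < enum_rank v)%N]%SET|.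

(* Coefficient of t in the boundary of s. As t is nonempty, vertices have zero
   boundary, so the homology is unreduced. *)
Definition incidence (s t : pow X) : F :=
  \sum_(v in val s | (val s :\ v)%SET == val t) face_sign (val s) v.

Definition boundary (c : chain F X) : chain F X :=
  [ffun t => \sum_s c s * incidence s t].

Fact boundary_linear : linear boundary.
Proof.
move=> a c d; apply/ffunP => t; rewrite !ffunE scaler_sumr -big_split /=.
by apply: eq_bigr => s _; rewrite !ffunE mulrDl scalerAl.
Qed.

HB.instance Definition _ :=
  GRing.isLinear.Build F (chain F X) (chain F X) _ boundary boundary_linear.

Definition simplex_chain (s : pow X) : chain F X := [ffun u => (u == s)%:R].

Definition chains k L : {vspace chain F X} :=
  <<[seq simplex_chain s | s : pow X <- enum L & #|val s| == k.+1]>>%VS.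

Definition cycles k L : {vspace chain F X} :=
  (chains k L :&: lker (linfun boundary))%VS.

Definition boundaries k L : {vspace chain F X} :=
  (linfun boundary @: chains k.+1 L)%VS.

(* Cycles modulo those cycles that are boundaries; by [boundaries_cycles] every
   boundary is a cycle when L is a simplicial complex. *)
Definition homology k L : lmodType F :=
  vquot (linfun (vsval : subvs_of (cycles k L) -> chain F X)
           @^-1: boundaries k L)%VS.

Lemma face_sign_swap (u : {set X}) v w : v \in u -> (enum_rank v < enum_rank w)%N ->
  face_sign u v * face_sign (u :\ v)%SET w = - (face_sign u w * face_sign (u :\ w)%SET v).
Proof.
move=> vu vw; have -> : face_sign (u :\ w)%SET v = face_sign u v.
  congr (_ ^+ _); apply: eq_card => x; rewrite !inE.
  by case: eqP => [->|_] //=; rewrite ltnNge ltnW // andbF.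
have -> : face_sign u w = - face_sign (u :\ v)%SET w.
  rewrite /face_sign (cardsD1 v [set x in u | _]%SET) !inE vu vw /= exprS mulN1r.
  by congr (- (_ ^+ _)); apply: eq_card => x; rewrite !inE andbA.
by rewrite mulNr opprK mulrC.
Qed.

Lemma incidence_sum (u t : pow X) :
  \sum_s incidence u s * incidence s t = 0.
Proof.
have -> : \sum_s incidence u s * incidence s t =
  \sum_(v in val u) \sum_(w in val u | (w != v) && ((val u :\ v :\ w)%SET == val t))
     face_sign (val u) v * face_sign (val u :\ v)%SET w.
  rewrite /incidence.
  under eq_bigr => s _ do rewrite big_distrl big_mkcondr /=.
  rewrite exchange_big /=; apply: eq_bigr => v vu.
  rewrite -big_mkcond /=.
  have [/eqP e0|n0] := boolP ((val u :\ v)%SET == finset.set0).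
    rewrite !big1 // => [w /and3P[wu wv _]|s /eqP e].
      by move/setP/(_ w): e0; rewrite !inE wv wu.
    by case/eqP: (valP s); exact: etrans (esym e) e0.
  rewrite (big_pred1 (Sub (val u :\ v)%SET n0 : pow X)); last first.
    by move=> s; rewrite -val_eqE /= eq_sym.
  rewrite big_distrr /=; apply: eq_bigl => w; rewrite !inE.
  by rewrite andbCA andbA.
rewrite pair_big_dep /=.
pose P (p : X * X) := [&& p.1 \in val u, p.2 \in val u & (val u :\ p.1 :\ p.2)%SET == val t].
pose E (p : X * X) := face_sign (val u) p.1 * face_sign (val u :\ p.1)%SET p.2.
rewrite (eq_bigr E) // (bigID (fun p : X * X => (enum_rank p.1 < enum_rank p.2)%N)) /=.
set A := \sum_(_ | _) _; set B := \sum_(_ | _) _.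
suff -> : A = - B by rewrite addNr.
rewrite /A /B (reindex_inj (h := fun p : X * X => (p.2, p.1))) /=; last by move=> [a b] [c d] [-> ->].
rewrite -sumrN; apply: eq_big => [[v w]|[v w] /andP[/andP[vu _] wv]] /=; last first.
  by move: vu => /= vu; rewrite /E /= face_sign_swap.
rewrite -!andbA /=.
have -> : (val u :\ w :\ v = val u :\ v :\ w)%SET by apply/setP => x; rewrite !inE andbCA.
case: (v \in _); case: (w \in _) => //=; rewrite [v == w]eq_sym.
case: (eqVneq w v) => [->|wv] //=.
congr (_ && _); case: ltngtP => // e.
by rewrite (enum_rank_inj (ord_inj e)) eqxx in wv.
Qed.

Lemma boundaryK (c : chain F X) : boundary (boundary c) = 0.
Proof.
apply/ffunP => t; rewrite !ffunE.
under eq_bigr => s _ do rewrite ffunE big_distrl /=.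
rewrite exchange_big big1 //= => u _.
under eq_bigr => s _ do rewrite -mulrA.
by rewrite -big_distrr /= incidence_sum mulr0.
Qed.

Definition is_complex (L : {set pow X}) : Prop :=
  forall s t : pow X, s \in L -> val t \subset val s -> t \in L.

Lemma boundaries_cycles k L : is_complex L -> (boundaries k L <= cycles k L)%VS.
Proof.
move=> cL; apply/subvP => _ /memv_imgP[c cC ->]; rewrite memv_cap memv_ker !lfunE /=.
rewrite boundaryK eqxx andbT.
suff : (linfun (boundary) @: chains k.+1 L <= chains k L)%VS.
  by move/subvP; apply; rewrite -[boundary c]lfunE; apply: memv_img.
rewrite limg_span; apply/span_subvP => d /mapP[e /mapP[s]].
rewrite mem_filter mem_enum => /andP[/eqP sk sL] -> ->; rewrite lfunE /= {d e}.
have -> : boundary (simplex_chain s) = \sum_t incidence s t *: simplex_chain t.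
  apply/ffunP => t; rewrite !ffunE sum_ffunE (bigD1 s) //= big1 ?addr0 => [|u /negbTE us].
    rewrite (bigD1 t) //= big1 ?addr0 => [|u /negbTE ut].
      by rewrite !ffunE !eqxx mul1r [RHS]mulr1.
    by rewrite !ffunE eq_sym ut [LHS]mulr0.
  by rewrite !ffunE us mul0r.
apply: memv_suml => t _; have [->|nz] := eqVneq (incidence s t) 0.
  by rewrite scale0r mem0v.
apply: memvZ; apply: memv_span; apply: map_f; rewrite mem_filter mem_enum.
have [v /andP[vs /eqP e]] : exists v, (v \in val s) && ((val s :\ v)%SET == val t).
  apply/existsP; apply: contraNT nz => /existsPn h; apply/eqP.
  by rewrite /incidence big1 // => v H; have := h v; rewrite H.
rewrite (cL s t sL) ?andbT -?e ?subD1set //.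
by move: sk; rewrite (cardsD1 v) vs add1n => -[->].
Qed.

Lemma chainsS k L L' : L \subset L' -> (chains k L <= chains k L')%VS.
Proof.
move=> /fintype.subsetP LL'; apply: sub_span => c /mapP[s].
rewrite mem_filter mem_enum => /andP[sk sL] ->; apply: map_f.
by rewrite mem_filter mem_enum sk LL'.
Qed.

Lemma cyclesS k L L' : L \subset L' -> (cycles k L <= cycles k L')%VS.
Proof. by move=> LL'; apply: capvS => //; apply: chainsS. Qed.

Lemma boundariesS k L L' :
  L \subset L' -> (boundaries k L <= boundaries k L')%VS.
Proof. by move=> LL'; apply: limgS; apply: chainsS. Qed.

Definition homology_class k L (z : subvs_of (cycles k L)) : homology k L :=
  vproj _ z.

Fact homology_class_linear k L : linear (@homology_class k L).
Proof. exact: vproj_linear. Qed.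

HB.instance Definition _ k L :=
  GRing.isLinear.Build F (subvs_of (cycles k L)) (homology k L) _
    (@homology_class k L) (@homology_class_linear k L).

Lemma homology_classP k L (z w : subvs_of (cycles k L)) :
  reflect (homology_class z = homology_class w)
    (vsval z - vsval w \in boundaries k L).
Proof.
suff -> : (vsval z - vsval w \in boundaries k L) =
  (z - w \in (linfun vsval @^-1: boundaries k L)%VS) by apply: vprojP.
by rewrite -memv_preim lfunE.
Qed.

Lemma homologyW k L (P : homology k L -> Prop) :
  (forall z, P (homology_class z)) -> forall a, P a.
Proof. by move=> Pz a; rewrite -[a]vproj_repr; apply: Pz. Qed.

(* The class of z is sent to the class of z; vsproj only changes the type. *)
Definition homology_map k L L' (LL' : L \subset L') (a : homology k L)
    : homology k L' :=
  homology_class (vsproj (cycles k L') (vsval (repr a))).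

Lemma homology_mapE k L L' (LL' : L \subset L') (z : subvs_of (cycles k L)) :
  homology_map LL' (homology_class z) =
  homology_class (vsproj (cycles k L') (vsval z)).
Proof.
have zcyc (w : subvs_of (cycles k L)) : vsval w \in cycles k L'.
  by apply: subvP (cyclesS k LL') _ _; apply: subvsP.
apply/homology_classP; rewrite !vsprojK //.
apply: subvP (boundariesS k LL') _ _.
by apply/homology_classP; apply: vproj_repr.
Qed.

Fact homology_map_linear k L L' (LL' : L \subset L') :
  linear (homology_map (k := k) LL').
Proof.
move=> x a b; elim/homologyW: a => z; elim/homologyW: b => w.
by rewrite -linearP !homology_mapE !linearP.
Qed.

HB.instance Definition _ k L L' (LL' : L \subset L') :=
  GRing.isLinear.Build F (homology k L) (homology k L') _
    (homology_map LL') (homology_map_linear LL').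

Lemma homology_map_id k L (LL : L \subset L) (a : homology k L) :
  homology_map LL a = a.
Proof. by elim/homologyW: a => z; rewrite homology_mapE vsvalK. Qed.

Lemma homology_map_comp k L L' L'' (h1 : L \subset L') (h2 : L' \subset L'')
    (h : L \subset L'') (a : homology k L) :
  homology_map h2 (homology_map h1 a) = homology_map h a.
Proof.
elim/homologyW: a => z; rewrite !homology_mapE vsprojK //.
exact: (subvP (cyclesS k h1) _ (subvsP _)).
Qed.

End Homology.

Definition sublevel (R : realType) (X : filtered_space R) (e : R)
    : {set pow X} :=
  [set s | filt s <= e]%SET.

Fact sublevel_complex (R : realType) (X : filtered_space R) (e : R) :
  is_complex (sublevel X e).
Proof.
move=> s t; rewrite !inE => se ts; apply: le_trans se; exact: filt_mono.
Qed.

Fact sublevelS (R : realType) (X : filtered_space R) (e e' : R) :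
  e <= e' -> sublevel X e \subset sublevel X e'.
Proof.
move=> ee'; apply/fintype.subsetP => s; rewrite !inE => /le_trans; exact.
Qed.

Definition persistent_homology (R : realType) (F : fieldType) (k : nat)
    (X : filtered_space R) : persistence_space R F :=
  @PersistenceSpace R F (fun e => homology F k (sublevel X e))
    (fun e e' ee' => homology_map (sublevelS X ee'))
    (fun e _ => homology_map_id _)
    (fun e e' e'' _ _ _ => homology_map_comp _ _ _).

Definition Dk (R : realType) (F : fieldType) (k : nat) (X : filtered_space R)
    : diagram R :=
  barcode (persistent_homology F k X).

Section Bottleneck.
Variable R : realType.
Local Open Scope ereal_scope.

(* The library has +oo - +oo = -oo, of absolute value +oo; the first branch
   restores the convention |oo - oo| = 0. *)
Definition ext_dist (x y : \bar R) : \bar R :=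
  if x == y then 0 else `|x - y|.

Definition point_dist (p q : R * \bar R) : \bar R :=
  maxe (ext_dist p.1%:E q.1%:E) (ext_dist p.2 q.2).

Definition pers (p : R * \bar R) : \bar R := p.2 - p.1%:E.

(* All terms are nonnegative on genuine diagrams. *)
Definition matching_cost (D1 D2 : diagram R)
    (B1 : {set 'I_(size D1)}) (B2 : {set 'I_(size D2)})
    (phi : {i | i \in B1} -> {j | j \in B2}) : \bar R :=
  maxe (\big[maxe/0]_(i : {i | i \in B1})
          point_dist (tnth (in_tuple D1) (val i))
                     (tnth (in_tuple D2) (val (phi i))))
    (maxe (\big[maxe/0]_(i in (~: B1)%SET)
             ((2^-1)%:E * pers (tnth (in_tuple D1) i)))
          (\big[maxe/0]_(j in (~: B2)%SET)
             ((2^-1)%:E * pers (tnth (in_tuple D2) j)))).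

(* An infimum over finitely many matchings, hence a minimum. *)
Definition dD (D1 D2 : diagram R) : \bar R :=
  ereal_inf [set c | exists (B1 : {set 'I_(size D1)}) (B2 : {set 'I_(size D2)})
                       (phi : {i | i \in B1} -> {j | j \in B2}),
               bijective phi /\ c = matching_cost phi]%classic.

Definition LD (alpha : {i01 R} -> diagram R) : \bar R :=
  ereal_sup [set l | exists (n : nat) (t : nat -> {i01 R}),
    [/\ (1 <= n)%N, (t 0%N)%:num = 0%R, (t n)%:num = 1%R,
        forall i, (i < n)%N -> ((t i)%:num < (t i.+1)%:num)%R &
        l = \sum_(0 <= i < n) dD (alpha (t i)) (alpha (t i.+1))]]%classic.

End Bottleneck.

(* Main.v *)
From HB Require Import structures.
Require Import Defs.
From mathcomp Require Import all_boot all_order all_algebra.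
From mathcomp Require Import all_classical all_reals all_analysis.
From mathcomp Require Import ring lra.

(** Along [gammaT T] the filtration moves in a straight line, so between the
    times s <= t it moves by at most (t - s) * distortion T in the sup norm.
    Everything therefore rests on the stability of persistence diagrams: two
    monotone functions on the simplices of a finite complex at sup distance at
    most eps have diagrams at bottleneck distance at most eps ([stability]).
    Summing along a partition of the unit interval telescopes to distortion T,
    which is dF X Y when T is optimal.

    Stability is proved by following the filtration along the segment from f to
    g.  Suppose first that no pair of simplices is ordered strictly one way by f
    and strictly the other way by g.  Sorting the simplices by f + g gives a
    total order compatible with both functions.  For a total order there is a
    basis of the chains, triangular with respect to it, in which the boundary
    operator sends each basis vector either to 0 or to another basis vector,
    injectively ([exists_adapted_basis]).  The resulting pairing x -> y of
    simplices (y kills the class created by x) depends on the order only, and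
    for every compatible filtration f the half-open intervals from f x to f y,
    together with those from f x to +oo for unpaired x, form the barcode
    ([persistent_homology_barcode]).  Matching the point of a pair for f with
    the point of the same pair for g moves coordinates by at most eps; when one
    of the two intervals is empty, the other lies within eps of the diagonal
    ([near_diagonal_pers], [matched_uncrossed]).

    In general, a pair of simplices ordered differently by f and g has equal
    values under some convex combination h of f and g.  The pairs ordered
    differently by f and h, or by h and g, form a proper subset of those ordered
    differently by f and g, so induction applies to both halves of the segment,
    and the two matchings compose ([matched_trans]).

    As [Dk] is an arbitrary choice among the barcodes of a module, the argument
    also needs that barcodes are unique up to order ([is_barcode_unique]): the
    ranks of the structure maps count the intervals containing two given
    points, and these counts determine the diagram ([diagram_eq_rank]). *)

Set Implicit Arguments.
Unset Strict Implicit.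
Unset Printing Implicit Defensive.

Import Order.TTheory GRing.Theory Num.Theory.
Local Open Scope ring_scope.

(** * Chains whose boundary has the smallest possible leading simplex *)

Section ReducedBasis.
Variables (F : fieldType) (X : finType) (r : pow X -> nat).
Hypothesis r_inj : injective r.
Implicit Types (x y z s t : pow X) (c d : chain F X).

(** A chain whose last simplex in the order r is x.  Homogeneity is required as
    well, so that a basis of such chains restricts to a basis in each degree. *)
Definition leads x c : Prop :=
  c x != 0 /\ forall y, c y != 0 -> (r y <= r x)%N /\ #|val y| = #|val x|.

(** One more than the position of the last simplex of c, so that the value 0 is
    left for the zero chain. *)
Definition low c : nat := \max_(y | c y != 0) (r y).+1.

Lemma low_leP c n :
  reflect (forall y, c y != 0 -> (r y < n)%N) (low c <= n)%N.
Proof. exact: bigmax_leqP. Qed.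

Lemma low0 : low 0 = 0%N.
Proof. by rewrite /low big_pred0 // => y; rewrite ffunE eqxx. Qed.

Lemma low_eq0 c : low c = 0%N -> c = 0.
Proof.
move=> c0; apply/ffunP => y; rewrite ffunE; apply/eqP/negPn/negP => cy.
by have /low_leP/(_ y cy) := leqnn (low c); rewrite c0.
Qed.

Lemma low_gt0P c n :
  low c = n.+1 -> exists2 y, c y != 0 & r y = n.
Proof.
move=> cn; have [y] : {y | c y != 0 & low c = (r y).+1}.
  apply: eq_bigmax_cond; rewrite lt0n; apply: contra_eq_neq cn => /eqP.
  by move=> /pred0P c0; rewrite /low big_pred0.
by move=> cy; rewrite cn => -[->]; exists y.
Qed.

Lemma boundary_support c t : boundary c t != 0 ->
  exists2 s, c s != 0 & #|val s| = #|val t|.+1.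
Proof.
rewrite ffunE => nz.
have [s] : exists s, c s * incidence F s t != 0.
  apply/existsP; apply: contraNT nz => /existsPn h; rewrite big1 // => s _.
  by have := h s; rewrite negbK => /eqP.
rewrite mulf_eq0 negb_or => /andP[cs inz].
have [v /andP[vs /eqP e]] :
    exists v, (v \in val s) && ((val s :\ v)%SET == val t).
  apply/existsP; apply: contraNT inz => /existsPn h.
  by rewrite /incidence big1 // => v H; have := h v; rewrite H.
by exists s => //; rewrite -e [LHS](cardsD1 v) vs.
Qed.

(** Minimality replaces the column reduction algorithm: a reduced chain is a
    column that no addition of earlier columns can reduce further. *)
Definition reduced x c : Prop :=
  leads x c /\
  forall d, leads x d -> (low (boundary c) <= low (boundary d))%N.

Lemma leads_simplex x : leads x (simplex_chain F x).
Proof.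
split=> [|y]; first by rewrite ffunE eqxx oner_neq0.
by rewrite ffunE; case: (eqVneq y x) => [->|]; rewrite ?eqxx.
Qed.

Lemma exists_reduced x : exists c, reduced x c.
Proof.
pose Q n := `[< exists c, leads x c /\ low (boundary c) = n >].
have exQ : exists n, Q n.
  by exists (low (boundary (simplex_chain F x))); apply/asboolP;
    exists (simplex_chain F x); split=> //; apply: leads_simplex.
case: (ex_minnP exQ) => n /asboolP[c [cx <-]] minn.
by exists c; split=> // d dx; apply: minn; apply/asboolP; exists d.
Qed.

Lemma leads_boundary x c y : leads x c -> boundary c y != 0 ->
  low (boundary c) = (r y).+1 -> leads y (boundary c).
Proof.
move=> [_ h] cy lowy; split=> // z cz; split.
  by have /low_leP/(_ z cz) := leqnn (low (boundary c)); rewrite lowy ltnS.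
have [s cs es] := boundary_support cz.
have [t ct et] := boundary_support cy.
by apply: succn_inj; rewrite -es -et (h _ cs).2 (h _ ct).2.
Qed.

(** If the boundaries of two reduced chains ended at the same simplex, the
    multiple of the earlier chain that cancels it could be subtracted from the
    later one, which keeps its leading simplex and contradicts minimality. *)
Lemma reduced_low_inj x x' c c' : reduced x c -> reduced x' c' ->
  low (boundary c) = low (boundary c') -> boundary c != 0 -> x = x'.
Proof.
wlog le_xx' : x x' c c' / (r x <= r x')%N.
  move=> hw; case/orP: (leq_total (r x) (r x')) => le; first exact: hw.
  move=> Rx Rx' e nz; symmetry; apply: (hw _ _ c' c) => //.
  apply: contraNneq nz => c'0; apply/eqP/low_eq0.
  by rewrite e c'0 low0.
move=> [cx minc] [c'x' minc'] e nz.
case: (ltngtP (r x) (r x')) le_xx' => // [lt_xx' _|/r_inj //].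
case def_low : (low (boundary c)) => [|n].
  by rewrite (low_eq0 def_low) eqxx in nz.
have [y cy ry] := low_gt0P def_low.
have [y' c'y ry'] := low_gt0P (etrans (esym e) def_low).
have yy' : y' = y by apply: r_inj; rewrite ry ry'.
rewrite {}yy' in c'y; rewrite -{}ry in def_low; clear y' ry'.
have [z cz ez] := boundary_support cy.
have [z' c'z ez'] := boundary_support c'y.
have exx' : #|val x| = #|val x'|.
  by rewrite -(cx.2 _ cz).2 -(c'x'.2 _ c'z).2 ez ez'.
pose a := boundary c' y / boundary c y.
have lead_d : leads x' (c' - a *: c).
  split.
    have -> : (c' - a *: c) x' = c' x'.
      rewrite !ffunE; have [->|/cx.2[]] := eqVneq (c x') 0.
        by rewrite scaler0 subr0.
      by rewrite leqNgt lt_xx'.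
    exact: c'x'.1.
  move=> w; have [c'w|/c'x'.2 //] := eqVneq (c' w) 0.
  rewrite !ffunE c'w add0r oppr_eq0 mulf_eq0 negb_or => /andP[_ /cx.2[le_wx ->]].
  by rewrite exx' (leq_trans le_wx (ltnW lt_xx')).
(* The coefficient a cancels the last simplex y of the boundary of c'. *)
have := minc' _ lead_d; rewrite -e def_low leqNgt => /negP[].
rewrite ltnS; apply/low_leP => w; rewrite linearB linearZ /=.
have [-> |wy] := eqVneq w y.
  rewrite ffunE [X in _ + X]ffunE [X in - X]ffunE -[_ *: _]/(_ * _).
  by rewrite divfK // subrr eqxx.
have small d0 :
    low (boundary d0) = (r y).+1 -> boundary d0 w != 0 -> (r w < r y)%N.
  move=> dl dw; have /low_leP/(_ w dw) := leqnn (low (boundary d0)).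
  by rewrite dl ltnS leq_eqVlt => /orP[/eqP/r_inj/eqP|//]; rewrite (negPf wy).
have [c'w|/(small _ (etrans (esym e) def_low)) //] := eqVneq (boundary c' w) 0.
have [cw|/(small _ def_low) //] := eqVneq (boundary c w) 0.
rewrite ffunE [X in X + _]c'w [X in _ + X]ffunE [X in - X]ffunE cw.
by rewrite scaler0 subr0 eqxx.
Qed.

End ReducedBasis.

(** * Bases pairing the simplices that create and destroy homology *)

Section AdaptedBasis.
Variables (F : fieldType) (X : finType) (r : pow X -> nat).
Hypothesis r_inj : injective r.
Implicit Types (x y z s t : pow X) (c d : chain F X).

(** Barannikov's normal form of the filtered chain complex: [b x = Some y] says
    that x kills the class created by y.  The boundary of e x is then exactly
    e y, which is what makes sublevel cycles and boundaries coordinate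
    subspaces. *)
Record adapted_basis (e : pow X -> chain F X) (b : pow X -> option (pow X)) :=
    AdaptedBasis {
  ab_leads : forall x, leads r x (e x);
  ab_cycle : forall x, b x = None -> boundary (e x) = 0;
  ab_kills : forall x y, b x = Some y -> boundary (e x) = e y;
  ab_card : forall x y, b x = Some y -> #|val x| = #|val y|.+1;
  ab_inj : forall x x' y, b x = Some y -> b x' = Some y -> x = x'
}.

(** Start from reduced chains e0 x and pair x with the last simplex y of the
    boundary of e0 x.  This boundary has leading simplex y and is a cycle, so it
    can replace e0 y.  The replacement does not disturb other pairs: a boundary
    with leading simplex y being available, minimality forces e0 y to be a
    cycle. *)
Lemma exists_adapted_basis : exists e b, adapted_basis e b.
Proof.
have [e0 red0] := choice (exists_reduced F r).
pose kills x y :=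
  (boundary (e0 x) y != 0) && (low r (boundary (e0 x)) == (r y).+1).
pose b x := [pick y | kills x y].
pose e y := if [pick x | kills x y] is Some x then boundary (e0 x) else e0 y.
have bP x y : b x = Some y -> kills x y by rewrite /b; case: pickP => // z h [<-].
have b0 x : b x = None -> boundary (e0 x) = 0.
  rewrite /b; case: pickP => // nk _; apply: contraTeq isT => nz.
  case def_low: (low r (boundary (e0 x))) => [|n].
    by rewrite (low_eq0 def_low) eqxx in nz.
  have [y cy ry] := low_gt0P def_low.
  by have := nk y; rewrite /kills cy def_low ry eqxx.
have kills_nz x y : kills x y -> boundary (e0 x) != 0.
  by move=> /andP[+ _]; apply: contra_neq => ->; rewrite ffunE.
have kills_inj x x' y : kills x y -> kills x' y -> x = x'.
  move=> k k'; apply: (reduced_low_inj r_inj (red0 x) (red0 x') _ (kills_nz _ _ k)).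
  by case/andP: k => _ /eqP ->; case/andP: k' => _ /eqP ->.
have kills_leads x y : kills x y -> leads r y (boundary (e0 x)).
  by case/andP=> cy /eqP; apply: (leads_boundary (red0 x).1 cy).
have killed x y : kills x y -> boundary (e0 y) = 0.
  move=> k; apply/(@low_eq0 _ _ r)/eqP; rewrite -leqn0.
  by have [_ /(_ _ (kills_leads _ _ k))] := red0 y; rewrite boundaryK low0.
have e_birth x y : kills x y -> e y = boundary (e0 x).
  move=> k; rewrite /e; case: pickP => [x' k'|/(_ x)]; last by rewrite k.
  by rewrite (kills_inj _ _ _ k k').
have e_death x y : b x = Some y -> e x = e0 x.
  move=> /bP /kills_nz nz; rewrite /e; case: pickP => // w /killed z.
  by rewrite z eqxx in nz.
exists e, b; split.
- move=> x; rewrite /e; case: pickP => [w /kills_leads //|_].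
  by case: (red0 x).
- move=> x /b0 bx; rewrite /e; case: pickP => // w _; exact: boundaryK.
- by move=> x y bxy; rewrite (e_death _ _ bxy) (e_birth _ _ (bP _ _ bxy)).
- move=> x y /bP /andP[/boundary_support[s cs <-] _].
  by have [[_ h] _] := red0 x; rewrite (h _ cs).2.
- by move=> x x' y /bP k /bP k'; apply: kills_inj k k'.
Qed.

End AdaptedBasis.

Section AdaptedTheory.
Variables (F : fieldType) (X : finType) (r : pow X -> nat).
Hypothesis r_inj : injective r.
Variables (e : pow X -> chain F X) (b : pow X -> option (pow X)).
Hypothesis eb : adapted_basis r e b.
Implicit Types (x y z s t : pow X) (c d : chain F X) (a : pow X -> F).

Lemma adapted_free a : \sum_x a x *: e x = 0 -> forall x, a x = 0.
Proof.
move=> sum0 x; apply: contraTeq isT => ax.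
have [y ay maxy] := @arg_maxnP _ x (fun x => a x != 0) r ax.
have := congr1 (fun c : chain F X => c y) sum0.
rewrite sum_ffunE ffunE (bigD1 y) //= big1 => [|z zy].
  rewrite addr0 ffunE => /eqP; rewrite mulf_eq0 (negPf ay) /=.
  by rewrite (negPf (ab_leads eb y).1).
rewrite ffunE; have [->|az] := eqVneq (a z) 0; first exact: mul0r.
have [->|ezy] := eqVneq (e z y) 0; first exact: mulr0.
have := ((ab_leads eb z).2 _ ezy).1; rewrite leq_eqVlt => /orP[/eqP/r_inj/eqP|].
  by rewrite eq_sym (negPf zy).
by have h : (r z <= r y)%N := maxy z az; rewrite ltnNge h.
Qed.

(** Triangular elimination.  A set S of simplices stands for a sublevel set in
    one degree; closedness makes the chains e x with x in S span all the chains
    supported in S. *)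
Lemma adapted_span (S : pred (pow X)) c :
  (forall x y, S x -> (r y <= r x)%N -> #|val y| = #|val x| -> S y) ->
  (forall y, c y != 0 -> S y) ->
  exists2 a, (forall y, a y != 0 -> S y) & c = \sum_x a x *: e x.
Proof.
move=> closedS; have [n] := ubnP (low r c).
elim: n c => // n IHn c; rewrite ltnS leq_eqVlt.
case/orP=> [/eqP def_low|]; last exact: IHn.
case: n IHn def_low => [|n] IHn def_low Sc.
  exists (fun=> 0) => [y|]; first by rewrite eqxx.
  by rewrite (low_eq0 def_low) big1 // => x _; rewrite scale0r.
have [y cy ry] := low_gt0P def_low.
have [ey ley] := ab_leads eb y.
pose q := c y / e y y.
have Sy := Sc y cy.
have d_supp z : (c - q *: e y) z != 0 -> z != y /\ (c z != 0 \/ e y z != 0).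
  have [->|zy] := eqVneq z y.
    by rewrite !ffunE -[_ *: _]/(_ * _) divfK // subrr eqxx.
  rewrite !ffunE; have [->|] := eqVneq (c z) 0; last by split=> //; left.
  have [->|] := eqVneq (e y z) 0; first by rewrite scaler0 subrr eqxx.
  by split=> //; right.
case: (IHn (c - q *: e y)) => [|z /d_supp[_ [/Sc//|/ley[le ez]]]|a Sa def_c].
- rewrite ltnS; apply/low_leP => z /d_supp[zy h].
  have : (r z <= n)%N.
    case: h => [cz|/ley[]]; last by rewrite ry.
    by have /low_leP/(_ z cz) := leqnn (low r c); rewrite def_low ltnS.
  by rewrite leq_eqVlt -ry => /orP[/eqP/r_inj/eqP|//]; rewrite (negPf zy).
- exact: closedS Sy le ez.
exists (fun z => a z + q *+ (z == y)) => [z|].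
  have [->//|_] := eqVneq z y; rewrite addr0; exact: Sa.
under eq_bigr do rewrite scalerDl.
rewrite big_split /= -def_c (bigD1 y) //= eqxx big1 ?addr0 ?subrK // => z.
move/negPf=> ->.
by rewrite scale0r.
Qed.

Lemma boundary_adapted a : boundary (\sum_x a x *: e x) =
  \sum_y (\sum_(x | b x == Some y) a x) *: e y.
Proof.
rewrite linear_sum; under [RHS]eq_bigr do rewrite scaler_suml.
rewrite (exchange_big_dep predT) //=; apply: eq_bigr => x _; rewrite linearZ /=.
case bx: (b x) => [y|]; last by rewrite (ab_cycle eb bx) scaler0 big_pred0.
by rewrite (ab_kills eb bx) (big_pred1 y) // => z; rewrite eq_sym.
Qed.

(** The e x with b x <> None have linearly independent boundaries, so they cannot
    occur in a cycle. *)
Lemma adapted_cycle a : boundary (\sum_x a x *: e x) = 0 ->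
  forall x, b x != None -> a x = 0.
Proof.
rewrite boundary_adapted => /adapted_free h x; case bx: (b x) => [y|] // _.
rewrite -[RHS](h y) (big_pred1 x) // => z; apply/eqP/eqP => [bz|->//].
exact: (ab_inj eb) bz bx.
Qed.

End AdaptedTheory.

(** * Recognizing a sum of interval modules from a basis *)

Section PvsIso.
Variables (R : realType) (F : fieldType).

Lemma linear_bij_inverse (U W : lmodType F) (f : {linear U -> W}) :
  bijective f -> exists g : {linear W -> U}, cancel f g /\ cancel g f.
Proof.
case=> g fg gf; pose mix := GRing.isLinear.Build F W U _ g (can2_linear fg gf).
pose gl : {linear W -> U} := HB.pack g mix.
by exists gl.
Qed.

Lemma pvs_iso_inverse (V W : persistence_space R F) :
  pvs_iso V W -> exists (f : forall t, {linear V t -> W t})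
    (g : forall t, {linear W t -> V t}),
  [/\ forall t, cancel (f t) (g t), forall t, cancel (g t) (f t),
      forall s t (st : s <= t) v, f t (pvs_map V st v) = pvs_map W st (f s v)
    & forall s t (st : s <= t) w, g t (pvs_map W st w) = pvs_map V st (g s w)].
Proof.
case=> f [bij_f nat_f]; exists f.
have hg t := linear_bij_inverse (bij_f t).
exists (fun t => projT1 (cid (hg t))).
split=> [t|t|//|s t st w]; try by case: cid => g [].
case: (cid (hg t)) => g /= [fg gf]; case: (cid (hg s)) => g' /= [fg' gf'].
by apply: (can_inj fg); rewrite gf nat_f gf'.
Qed.

Lemma pvs_iso_sym (V W : persistence_space R F) : pvs_iso V W -> pvs_iso W V.
Proof.
move=> /pvs_iso_inverse[f [g [fg gf _ nat_g]]]; exists g; split=> // t.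
exact: (Bijective (gf t) (fg t)).
Qed.

End PvsIso.

Section Realize.
Variables (R : realType) (F : fieldType) (V : persistence_space R F).
Variables (T : eqType) (p : T -> R * \bar R) (v : T -> forall t, V t).

(** An interval module has fibre 'rV_1 or 'rV_0; this is the map out of it
    determined by the image z of the generator. *)
Definition row_val (n : nat) (W : lmodType F) (z : W) (u : 'rV[F]_n) : W :=
  \sum_j u 0 j *: z.

Fact row_val_linear n W z : linear (@row_val n W z).
Proof.
move=> a u u'; rewrite /row_val scaler_sumr -big_split; apply: eq_bigr => j _.
by rewrite !mxE scalerDl scalerA.
Qed.

(** The morphism from the sum of the interval modules of the p x sending the
    generator of the summand of index x to the family v x. *)
Fixpoint realize (s : seq T) (t : R) {struct s} :
    barcode_module F (map p s) t -> V t :=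
  match s return barcode_module F (map p s) t -> V t with
  | [::] => fun=> 0
  | x :: s' =>
      fun w : ('rV[F]_(in_interval (p x) t)
               * barcode_module F (map p s') t)%type =>
      row_val (v x t) w.1 + realize w.2
  end.

Fact realize_linear s t : linear (@realize s t).
Proof.
elim: s => [|x s IHs] a w w' /=; first by rewrite scaler0 addr0.
by rewrite IHs row_val_linear scalerDr addrACA.
Qed.

HB.instance Definition _ s t := GRing.isLinear.Build F _ _ _
  (@realize s t) (@realize_linear s t).

(** Compatibility of the structure maps with [row_val], stated over booleans m
    and n: case analysis on the membership of the two times in the interval is
    possible only once the dimensions are abstracted from it. *)
Lemma row_val_pid (m n : bool) (W W' : lmodType F) (f : {linear W -> W'}) z z'
    (u : 'rV[F]_m) :
  (m -> f z = z') -> (m -> ~~ n -> z' = 0) ->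
  row_val z' (u *m pid_mx 1 : 'rV_n) = f (row_val z u).
Proof.
case: m u => u; last first.
  rewrite [u]thinmx0 mul0mx /row_val !big_ord0 linear0 big1 // => j _.
  by rewrite mxE scale0r.
move=> /(_ isT) fz /(_ isT); rewrite /row_val big_ord1 linearZ fz /=.
case: n => [_|/(_ isT)->]; last by rewrite big_ord0 scaler0.
by rewrite big_ord1 pid_mx_1 mulmx1.
Qed.

Lemma realize_nat (s : seq T) :
  (forall x, x \in s -> forall a c (ac : a <= c), in_interval (p x) a ->
    pvs_map V ac (v x a) = v x c /\ (~~ in_interval (p x) c -> v x c = 0)) ->
  forall a c (ac : a <= c) w,
  @realize s c (pvs_map _ ac w) = pvs_map V ac (realize w).
Proof.
elim: s => [|x s IHs] h a c ac w /=; first by rewrite linear0.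
rewrite linearD; congr (_ + _).
  by apply: row_val_pid => xa; case: (h x (mem_head _ _) a c ac xa).
by apply: IHs => y ys; apply: h; rewrite inE ys orbT.
Qed.

Lemma row_val_const (m : bool) (W : lmodType F) (z : W) k :
  row_val z (const_mx k : 'rV_m) = if m then k *: z else 0.
Proof. by case: m; rewrite /row_val (big_ord1, big_ord0) // mxE. Qed.

Lemma realize_surj (s : seq T) t (a : T -> F) :
  exists w : barcode_module F (map p s) t,
  realize w = \sum_(x <- s | in_interval (p x) t) a x *: v x t.
Proof.
elim: s => [|x s [w def_w]]; first by exists 0; rewrite big_nil.
exists (const_mx (a x), w); rewrite /= big_cons def_w row_val_const.
by case: in_interval; rewrite ?add0r.
Qed.

Lemma realize_coord (s : seq T) t (w : barcode_module F (map p s) t) : uniq s ->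
  exists a : T -> F,
    realize w = \sum_(x <- s | in_interval (p x) t) a x *: v x t /\
    ((forall x, x \in s -> in_interval (p x) t -> a x = 0) -> w = 0).
Proof.
elim: s w => [|x s IHs] /= w; first by exists (fun=> 0); rewrite big_nil thinmx0.
case: w => u w /= /andP[xs us]; have [a [def_w a0]] := IHs w us.
exists (fun y => if y == x then \sum_j u 0 j else a y); split.
  rewrite /= big_cons eqxx def_w.
  have -> : \sum_(y <- s | in_interval (p y) t)
        (if y == x then \sum_j u 0 j else a y) *: v y t
      = \sum_(y <- s | in_interval (p y) t) a y *: v y t.
    rewrite big_seq_cond [RHS]big_seq_cond; apply: eq_bigr => y /andP[ys _].
    by case: eqP ys xs => // -> ->.
  move: u; rewrite /row_val.
  by case: in_interval => u; rewrite !(big_ord1, big_ord0) ?add0r.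
move=> h; congr (_, _).
  have := h x (mem_head _ _); rewrite eqxx; move: u {def_w h}.
  case: in_interval => u; last by rewrite [u]thinmx0.
  by move=> /(_ isT); rewrite big_ord1 => u0; apply/rowP => j; rewrite ord1 u0 mxE.
apply: a0 => y ys yt; have := h y; rewrite inE ys orbT => /(_ isT yt).
by case: eqP ys xs => // -> ->.
Qed.

(** A barcode is recognized from a compatible family of bases: each v x is
    defined at every time, is transported by the structure maps as soon as it
    is born, vanishes once p x is over, and those alive at time t form a
    basis. *)
Lemma pvs_iso_barcode (s : seq T) : uniq s ->
  (forall x, x \in s -> forall a c (ac : a <= c), in_interval (p x) a ->
    pvs_map V ac (v x a) = v x c /\ (~~ in_interval (p x) c -> v x c = 0)) ->
  (forall t (a : T -> F), \sum_(x <- s | in_interval (p x) t) a x *: v x t = 0 ->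
     forall x, x \in s -> in_interval (p x) t -> a x = 0) ->
  (forall t (u : V t), exists a : T -> F,
     u = \sum_(x <- s | in_interval (p x) t) a x *: v x t) ->
  pvs_iso V (barcode_module F (map p s)).
Proof.
move=> us nat_v free_v span_v; apply: pvs_iso_sym.
exists (fun t => @realize s t : {linear _ -> _}); split; last exact: realize_nat.
move=> t.
have surj (u : V t) : exists w, @realize s t w = u.
  by have [a ->] := span_v t u; apply: realize_surj.
have [g rg] := choice surj.
have inj : injective (@realize s t).
  move=> w w' /eqP; rewrite -subr_eq0 -linearB => /eqP ww'.
  apply/eqP; rewrite -subr_eq0.
  have [a [def_w w0]] := realize_coord (w - w') us.
  by apply/eqP/w0/free_v; rewrite -def_w.
exists g => //; exact: inj_can_sym rg inj.
Qed.

End Realize.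

(** * The barcode read off an adapted basis *)

Lemma span_support (F : fieldType) (X : finType) (S : seq (chain F X)) c y :
  c \in <<S>>%VS -> c y != 0 -> exists2 d, d \in S & d y != 0.
Proof.
rewrite -[S]/(val (in_tuple S)) => /coord_span ->; rewrite sum_ffunE => nz.
have [i] : exists i, (coord (in_tuple S) i c *: (in_tuple S)`_i) y != 0.
  apply/existsP; apply: contraNT nz => /existsPn h; rewrite big1 // => i _.
  by have := h i; rewrite negbK => /eqP.
rewrite ffunE mulf_eq0 negb_or => /andP[_ nzi].
by exists (in_tuple S)`_i => //; apply: mem_nth.
Qed.

Lemma chainsP (F : fieldType) (X : finType) k (L : {set pow X}) (c : chain F X) :
  reflect (forall y, c y != 0 -> y \in L /\ #|val y| = k.+1) (c \in chains F k L).
Proof.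
apply: (iffP idP) => [|h].
  move=> cs y /(span_support cs)[_ /mapP[s + ->]].
  rewrite mem_filter mem_enum ffunE => /andP[/eqP sk sL].
  by case: (eqVneq y s) => [->|]; rewrite ?eqxx.
have -> : c = \sum_y c y *: simplex_chain F y.
  apply/ffunP => y; rewrite sum_ffunE (bigD1 y) //= big1 => [|x /negPf xy].
    by rewrite !ffunE eqxx addr0 [RHS]mulr1.
  by rewrite !ffunE eq_sym xy [LHS]mulr0.
apply: memv_suml => y _; have [->|/h[yL yk]] := eqVneq (c y) 0.
  by rewrite scale0r mem0v.
by apply/memvZ/memv_span/map_f; rewrite mem_filter mem_enum yk eqxx.
Qed.

Section Pairing.
Variables (R : realType) (X : finType) (b : pow X -> option (pow X)).

(** The class created by x lives from f x to death f x; this interval is empty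
    when the simplex killing x enters at the same time as x. *)
Definition death (f : pow X -> R) (x : pow X) : \bar R :=
  if [pick y | b y == Some x] is Some y then (f y)%:E else +oo%E.

Definition pairing_point (f : pow X -> R) (x : pow X) : R * \bar R :=
  (f x, death f x).

(** Only the pairing b enters, not the filtration: the same list indexes the
    points of the diagrams of all the filtrations compatible with one order. *)
Definition births (k : nat) : seq (pow X) :=
  [seq x : pow X <- enum {: pow X} | (#|val x| == k.+1) && (b x == None)].

End Pairing.

Section PersistentHomologyBarcode.
Variables (R : realType) (F : fieldType) (k : nat) (X : filtered_space R).
Variables (r : pow X -> nat) (e : pow X -> chain F X) (b : pow X -> option (pow X)).
Local Notation fX := (@filt R X).
Let L t := sublevel X t.
Implicit Types (x y : pow X) (t : R).
Hypothesis r_inj : injective r.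
Hypothesis r_filt : forall x y, (r x <= r y)%N -> filt x <= filt y.
Hypothesis eb : adapted_basis r e b.

Definition proper_births := [seq x <- births b k |
  ((pairing_point b fX x).1%:E < (pairing_point b fX x).2)%E].

Lemma death_le t x :
  (death b fX x <= t%:E)%E -> exists2 y, b y = Some x & filt y <= t.
Proof.
by rewrite /death; case: pickP => [y /eqP bx|_]; rewrite ?lee_fin // => h; exists y.
Qed.

Lemma lt_death t x y : (t%:E < death b fX x)%E -> b y = Some x -> t < filt y.
Proof.
rewrite /death; case: pickP => [z /eqP bz|/(_ y)]; last first.
  by move=> + _ h; rewrite h eqxx.
by rewrite lte_fin => + bx; rewrite (ab_inj eb bx bz).
Qed.

Lemma adapted_chain j t x : #|val x| = j.+1 -> filt x <= t -> e x \in chains F j (L t).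
Proof.
move=> xk xt; apply/chainsP => y /(ab_leads eb x).2[yx ->]; split=> //.
by rewrite inE (le_trans (r_filt yx)).
Qed.

Lemma adapted_cycles t x : #|val x| = k.+1 -> b x = None -> filt x <= t ->
  e x \in cycles F k (L t).
Proof.
move=> xk bx xt; rewrite memv_cap adapted_chain //= memv_ker lfunE /=.
by rewrite (ab_cycle eb bx).
Qed.

Lemma adapted_boundaries t x y : #|val x| = k.+1 -> b y = Some x -> filt y <= t ->
  e x \in boundaries F k (L t).
Proof.
move=> xk bx yt; rewrite -(ab_kills eb bx) -(lfunE (boundary (X := X))).
by apply/memv_img/adapted_chain; rewrite // (ab_card eb bx) xk.
Qed.

(** The sublevel set at t being an initial segment of the order, chains on it are
    combinations of the e x with x in it. *)
Lemma chain_adapted j t c : c \in chains F j (L t) ->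
  exists2 a : pow X -> F, (forall x, a x != 0 -> filt x <= t /\ #|val x| = j.+1)
    & c = \sum_x a x *: e x.
Proof.
move=> /chainsP cL.
pose S x := (filt x <= t) && (#|val x| == j.+1).
have [||a Sa ->] := adapted_span r_inj eb (S := S) (c := c).
- by move=> x y /andP[xt xj] yx e_yx; rewrite /S e_yx xj (le_trans (r_filt yx)).
- by move=> y /cL; rewrite inE /S => -[-> ->] /=.
by exists a => // x /Sa /andP[? /eqP].
Qed.

Lemma mem_proper_births x : (x \in proper_births) =
  [&& #|val x| == k.+1, b x == None & ((fX x)%:E < death b fX x)%E].
Proof. by rewrite mem_filter mem_filter mem_enum andbT andbC andbA. Qed.

Lemma proper_birthsP x : x \in proper_births ->
  [/\ #|val x| = k.+1, b x = None & ((fX x)%:E < death b fX x)%E].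
Proof. by rewrite mem_proper_births => /and3P[/eqP ? /eqP ?]. Qed.

Definition birth_class (x : pow X) (t : R) : homology F k (L t) :=
  homology_class (vsproj (cycles F k (L t)) (e x)).

Lemma birth_class_eq0 t x : #|val x| = k.+1 -> b x = None -> filt x <= t ->
  (death b fX x <= t%:E)%E -> birth_class x t = 0.
Proof.
move=> xk bx xt /death_le[y bxy yt].
rewrite -[RHS](linear0 (homology_class (k := k) (L := L t))).
apply/homology_classP; rewrite linear0 addr0 vsprojK ?adapted_cycles //.
exact: adapted_boundaries bxy yt.
Qed.

Lemma birth_class_nat x a c (ac : a <= c) : x \in proper_births ->
  in_interval (pairing_point b fX x) a ->
  homology_map (sublevelS X ac) (birth_class x a) = birth_class x c /\
  (~~ in_interval (pairing_point b fX x) c -> birth_class x c = 0).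
Proof.
move=> /proper_birthsP[xk bx xd] /andP[/= xa ad].
have xc := le_trans xa ac; split.
  by rewrite /birth_class homology_mapE vsprojK // adapted_cycles.
by rewrite /in_interval /= xc /= -leNgt => dc; apply: birth_class_eq0.
Qed.

Lemma birth_class_sum t (a : pow X -> F) :
  let I x := (x \in proper_births) && in_interval (pairing_point b fX x) t in
  exists z : subvs_of (cycles F k (L t)), vsval z = \sum_(x | I x) a x *: e x /\
  \sum_(x <- proper_births | in_interval (pairing_point b fX x) t)
     a x *: birth_class x t
     = homology_class z.
Proof.
move=> I; exists (vsproj _ (\sum_(x | I x) a x *: e x)).
rewrite vsprojK; last first.
  apply: memv_suml => x /andP[/proper_birthsP[xk bx xd] /andP[/= xt td]].
  exact/memvZ/adapted_cycles.
split=> //; rewrite !linear_sum /= big_filter_cond big_filter_cond big_enum_cond /=.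
apply: eq_big => [x|x _]; last by rewrite !linearZ.
by rewrite /I mem_proper_births -!andbA.
Qed.

(** A combination of cycles e x that bounds in the sublevel set is a combination
    of those e x whose killing simplex is already there, that is, of classes
    that are dead at time t. *)
Lemma birth_class_free t (a : pow X -> F) :
  \sum_(x <- proper_births | in_interval (pairing_point b fX x) t)
     a x *: birth_class x t = 0 ->
  forall x, x \in proper_births -> in_interval (pairing_point b fX x) t -> a x = 0.
Proof.
have [z [def_z ->]] := birth_class_sum t a.
rewrite -[RHS](linear0 (homology_class (k := k) (L := L t))) => /homology_classP.
rewrite linear0 addr0 def_z => /memv_imgP[c /chain_adapted[a' Sa' ->]].
rewrite lfunE /= (boundary_adapted eb) big_mkcond => /eqP.
rewrite -subr_eq0 -sumrB => /eqP sum0 x xs xt.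
have /adapted_free : \sum_x
    ((if (x \in proper_births) && in_interval (pairing_point b fX x) t
      then a x else 0) - \sum_(y | b y == Some x) a' y) *: e x = 0.
  rewrite -[RHS]sum0; apply: eq_bigr => y _; rewrite scalerBl.
  by case: ifP; rewrite ?scale0r.
move=> /(_ r r_inj b eb x); rewrite xs xt /= big1 ?subr0 // => y /eqP bx.
apply: contraTeq isT => /Sa'[yt _]; case/andP: xt => _ /= td.
by have := lt_death td bx; rewrite ltNge yt.
Qed.

(** In the coordinates of the adapted basis, a cycle involves only simplices that
    kill nothing, and those already dead contribute boundaries. *)
Lemma birth_class_span t (u : homology F k (L t)) : exists a : pow X -> F, u =
  \sum_(x <- proper_births | in_interval (pairing_point b fX x) t)
     a x *: birth_class x t.
Proof.
elim/homologyW: u => z.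
have := subvsP z; rewrite memv_cap memv_ker lfunE /=.
case/andP=> /chain_adapted[a Sa def_z].
rewrite def_z => /eqP /(adapted_cycle r_inj eb) a0.
exists a; have [w [def_w ->]] := birth_class_sum t a.
apply/homology_classP; rewrite def_z def_w [X in _ - X]big_mkcond -sumrB.
apply: memv_suml => x _; case: ifPn; first by rewrite subrr mem0v.
rewrite subr0 => nI; have [->|ax] := eqVneq (a x) 0; first by rewrite scale0r mem0v.
have [xt xk] := Sa _ ax.
have bx : b x = None by apply: contra_neqP ax => /eqP /a0.
have /death_le[y bxy yt] : (death b fX x <= t%:E)%E.
  rewrite leNgt; apply: contra nI => td.
  rewrite mem_proper_births xk bx !eqxx /in_interval /= xt td !andbT.
  by rewrite (le_lt_trans _ td) // lee_fin.
exact/memvZ/(adapted_boundaries xk bxy).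
Qed.

(** Empty intervals are discarded.  The pairing comes from the order, the
    endpoints from the filtration. *)
Lemma persistent_homology_barcode :
  is_barcode (persistent_homology F k X)
    [seq p <- map (pairing_point b fX) (births b k) | (p.1%:E < p.2)%E].
Proof.
rewrite filter_map; split=> [p /mapP[x + ->]|].
  by rewrite mem_filter => /andP[].
apply: (@pvs_iso_barcode _ _ (persistent_homology F k X) _ _ birth_class).
- by do 2!apply: filter_uniq; exact: enum_uniq.
- by move=> x xs a c ac; apply: birth_class_nat.
- exact: birth_class_free.
- exact: birth_class_span.
Qed.

End PersistentHomologyBarcode.

(** * Uniqueness of barcodes *)

Section Rank.
Variables (R : realType) (F : fieldType).
Implicit Types V W : persistence_space R F.

(** The structure map from s to t has rank n.  Fibres of a persistence space are
    bare modules without a dimension, so rank is expressed by factorizations: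
    the identity of F^n factors through the map (rank at least n), and the map
    factors through F^n (rank at most n). *)
Definition has_rank V (s t : R) (st : s <= t) (n : nat) : Prop :=
  exists (g : {linear 'rV[F]_n -> V s}) (h : {linear V t -> 'rV[F]_n})
    (g' : {linear V s -> 'rV[F]_n}) (h' : {linear 'rV[F]_n -> V t}),
  (forall u, h (pvs_map V st (g u)) = u) /\
  (forall v, pvs_map V st v = h' (g' v)).

Lemma linear_retract_leq (m n : nat) (f : {linear 'rV[F]_n -> 'rV[F]_m})
  (f' : {linear 'rV[F]_m -> 'rV[F]_n}) : cancel f f' -> (n <= m)%N.
Proof.
move=> ff'; apply: (@mulmx1_min F n m (lin1_mx f) (lin1_mx f')).
by apply/row_matrixP => i; rewrite !rowE mulmxA !mul_rV_lin1 /= ff' mulmx1.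
Qed.

Lemma has_rank_unique V s t (st : s <= t) m n :
  has_rank V st m -> has_rank V st n -> m = n.
Proof.
move=> [g [h [g' [h' [gh gh']]]]] [i [j [i' [j' [ij ij']]]]].
apply/eqP; rewrite eqn_leq; apply/andP; split.
  by apply: (@linear_retract_leq _ _ (i' \o g) (h \o j')) => u /=; rewrite -ij' gh.
by apply: (@linear_retract_leq _ _ (g' \o i) (j \o h')) => u /=; rewrite -gh' ij.
Qed.

Lemma has_rank_iso V W s t (st : s <= t) n :
  pvs_iso V W -> has_rank V st n -> has_rank W st n.
Proof.
move=> /pvs_iso_inverse[f [f' [ff' f'f nat_f nat_f']]] [g [h [g' [h' [gh gh']]]]].
exists (f s \o g), (h \o f' t), (g' \o f' s), (f t \o h'); split=> [u|w] /=.
  by rewrite -nat_f ff' gh.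
by rewrite -gh' nat_f f'f.
Qed.

Lemma has_rank_zero s t (st : s <= t) : has_rank (pvs_zero R F) st 0.
Proof.
by exists idfun, idfun, idfun, idfun; split=> u; rewrite [LHS]thinmx0 [RHS]thinmx0.
Qed.

Lemma has_rank_interval p s t (st : s <= t) :
  has_rank (interval_module F p) st (in_interval p s && in_interval p t).
Proof.
set a := in_interval p s; set c := in_interval p t; set m : nat := _ && _.
exists (mulmxr (pid_mx 1 : 'M[F]_(m, a))), (mulmxr (pid_mx 1 : 'M[F]_(c, m))),
  (mulmxr (pid_mx 1 : 'M[F]_(a, m))), (mulmxr (pid_mx 1 : 'M[F]_(m, c))).
rewrite /= /interval_map -/a -/c {}/m.
case: a; case: c; rewrite /=; split=> u; rewrite ?pid_mx_1 ?mulmx1 //;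
  first [by rewrite [LHS]thinmx0 [RHS]thinmx0 | by rewrite [u]thinmx0 !mul0mx].
Qed.

Lemma linear_pair (U V W : lmodType F)
    (f : {linear U -> V}) (g : {linear U -> W}) :
  exists h : {linear U -> (V * W)%type}, forall u, h u = (f u, g u).
Proof.
have lin : linear (fun u => (f u, g u)) by move=> a u v; rewrite !linearP.
pose h : {linear U -> (V * W)%type} := HB.pack (fun u => (f u, g u))
  (GRing.isLinear.Build F U (V * W)%type _ _ lin).
by exists h.
Qed.

Lemma linear_copair (U V W : lmodType F)
    (f : {linear V -> U}) (g : {linear W -> U}) :
  exists h : {linear (V * W)%type -> U}, forall p, h p = f p.1 + g p.2.
Proof.
pose h0 (p : (V * W)%type) := f p.1 + g p.2.
have lin : linear h0.
  by move=> a u v; rewrite /h0 !linearP scalerDr addrACA.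
pose h : {linear (V * W)%type -> U} := HB.pack h0
  (GRing.isLinear.Build F (V * W)%type U _ _ lin).
by exists h.
Qed.

Lemma has_rank_sum V W s t (st : s <= t) m n :
  has_rank V st m -> has_rank W st n -> has_rank (pvs_sum V W) st (m + n).
Proof.
move=> [g [h [g' [h' [gh gh']]]]] [i [j [i' [j' [ij ij']]]]].
have [f1 E1] := linear_pair (g \o lsubmx) (i \o rsubmx).
have [f2 E2] := linear_copair
  (mulmxr (row_mx 1%:M 0) \o h) (mulmxr (row_mx 0 1%:M) \o j).
have [f3 E3] := linear_copair
  (mulmxr (row_mx 1%:M 0) \o g') (mulmxr (row_mx 0 1%:M) \o i').
have [f4 E4] := linear_pair (h' \o lsubmx) (j' \o rsubmx).
exists f1, f2, f3, f4; split=> [u|v].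
  rewrite E2 /= E1 /pvs_sum_map /= gh ij !mul_mx_row !mulmx1 !mulmx0.
  by rewrite add_row_mx addr0 add0r hsubmxK.
rewrite E4 E3 /= /pvs_sum_map gh' ij' !mul_mx_row !mulmx1 !mulmx0.
by rewrite add_row_mx addr0 add0r row_mxKl row_mxKr.
Qed.

Lemma has_rank_barcode (D : diagram R) s t (st : s <= t) :
  has_rank (barcode_module F D) st
    (count (fun p => in_interval p s && in_interval p t) D).
Proof.
elim: D => [|p D IHD]; first exact: has_rank_zero.
exact: has_rank_sum (has_rank_interval p st) IHD.
Qed.

End Rank.

Section Uniqueness.
Variable R : realType.
Implicit Types D : diagram R.

Lemma exists_seq_min (T : eqType) (d : Order.disp_t) (O : orderType d)
    (f : T -> O) (s : seq T) x :
  x \in s -> exists2 y, y \in s & forall z, z \in s -> (f y <= f z)%O.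
Proof.
move: x; elim: s => // x0 [|x1 s] IHs x _.
  by exists x0; rewrite ?mem_head // => z; rewrite inE => /eqP ->.
have [y ys miny] := IHs x1 (mem_head _ _).
case: (leP (f y) (f x0)) => [le|/ltW le].
  exists y; first by rewrite inE ys orbT.
  by move=> z; rewrite inE => /predU1P[->|/miny].
exists x0; first exact: mem_head.
by move=> z; rewrite inE => /predU1P[->//|/miny]; apply: le_trans.
Qed.

(** Between the finitely many values below d and d itself there is room for a
    real t: right ends beyond t are then at least d. *)
Lemma exists_before (l : seq (\bar R)) (x : R) (d : \bar R) : (x%:E < d)%E ->
  exists t : R, [/\ x <= t, (t%:E < d)%E
    & forall y, y \in l -> (y < d)%E -> (y <= t%:E)%E].
Proof.
move=> xd; elim: l => [|y l [t [xt td maxt]]]; first by exists x.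
have [yd|dy] := ltP y d; last first.
  exists t; split=> // z; rewrite inE => /predU1P[->|/maxt//].
  by rewrite ltNge dy.
have [yt|ty] := leP y t%:E.
  by exists t; split=> // z; rewrite inE => /predU1P[->|/maxt].
case: y yd ty => [y yd|/lt_le_trans/(_ (leey d))|_]; last 2 first.
- by rewrite ltxx.
- by rewrite ltNge leNye.
rewrite lte_fin => ty.
exists y; split=> //; first exact: le_trans xt (ltW ty).
move=> z; rewrite inE => /predU1P[->//|zl /(maxt z zl)/le_trans]; apply.
by rewrite lee_fin ltW.
Qed.

Definition rank_count D (s t : R) :=
  count (fun p => in_interval p s && in_interval p t) D.

(** Let p have the smallest left end, and the largest right end among intervals
    starting there.  Only intervals starting at p.1 contain p.1, and for t close
    enough to p.2 only p itself contains both p.1 and t; so p is detected by the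
    rank from p.1 to t. *)
Lemma extreme_point_mem D D' p :
  (forall s t, s <= t -> rank_count D s t = rank_count D' s t) ->
  p \in D -> (p.1%:E < p.2)%E ->
  (forall q, q \in D' -> p.1 <= q.1) ->
  (forall q, q \in D' -> q.1 = p.1 -> (q.2 <= p.2)%E) ->
  p \in D'.
Proof.
move=> eqc pD vp minp maxp.
have [t [pt td maxt]] := exists_before (map snd D') vp.
have : (0 < rank_count D p.1 t)%N.
  by rewrite -has_count; apply/hasP; exists p; rewrite // /in_interval lexx vp pt td.
rewrite eqc // -has_count => /hasP[q qD' /andP[/andP[q1 _] /andP[_ q2]]].
have e1 : q.1 = p.1 by apply/eqP; rewrite eq_le q1 minp.
have /orP[/eqP e2|lt2] : (q.2 == p.2) || (q.2 < p.2)%E by rewrite -le_eqVlt maxp.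
  by case: p q e1 e2 qD' {pD vp minp maxp pt td maxt q1 q2} => [? ?] [? ?] /= -> ->.
by have := maxt q.2 (map_f _ qD') lt2; rewrite leNgt q2.
Qed.

Lemma rank_count_rem D p s t : p \in D ->
  rank_count D s t =
  ((in_interval p s && in_interval p t) + rank_count (rem p D) s t)%N.
Proof. by move=> /perm_to_rem/permP h; rewrite /rank_count h. Qed.

(** By induction on the size: an extreme point of the two diagrams taken together
    belongs to both, and removing it changes the counts equally. *)
Lemma diagram_eq_rank D D' :
  (forall p, p \in D -> (p.1%:E < p.2)%E) ->
  (forall p, p \in D' -> (p.1%:E < p.2)%E) ->
  (forall s t, s <= t -> rank_count D s t = rank_count D' s t) -> perm_eq D D'.
Proof.
have [n] := ubnP (size D); elim: n D D' => // n IHn D D' size_n vD vD' eqc.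
case def_S: (D ++ D') => [|p0 S0].
  move: (congr1 size def_S); rewrite size_cat.
  by case: D D' {def_S eqc vD vD' size_n} => [|? ?] [].
have [p1 p1S minp1] :
    exists2 y, y \in D ++ D' & forall z, z \in D ++ D' -> (y.1 <= z.1).
  by apply: (@exists_seq_min _ _ R fst _ p0); rewrite def_S mem_head.
have p1S' : p1 \in [seq q <- D ++ D' | q.1 == p1.1] by rewrite mem_filter eqxx.
(* The dual order turns the minimum into a maximum of right ends. *)
have [p + maxp] := @exists_seq_min (R * \bar R)%type _ (\bar R)^d%O snd _ _ p1S'.
rewrite mem_filter mem_cat => /andP[/eqP ep1 pS].
have vp : (p.1%:E < p.2)%E by case/orP: pS => [/vD|/vD'].
have ext (E : diagram R) : {subset E <= D ++ D'} ->
    (forall q, q \in E -> p.1 <= q.1) /\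
    (forall q, q \in E -> q.1 = p.1 -> (q.2 <= p.2)%E).
  move=> sE; split=> q /sE qS; first by rewrite ep1 minp1.
  by move=> eq1; have := maxp q; rewrite mem_filter qS eq1 ep1 eqxx => /(_ isT).
have [|minD maxD] := ext D; first by move=> q qD; rewrite mem_cat qD.
have [|minD' maxD'] := ext D'; first by move=> q qD; rewrite mem_cat qD orbT.
have pD : p \in D.
  case/orP: pS => // pD'; apply: extreme_point_mem pD' vp minD maxD => s t st.
  by rewrite eqc.
have pD' : p \in D' by apply: extreme_point_mem eqc pD vp minD' maxD'.
rewrite (perm_trans (perm_to_rem pD)) // perm_sym (perm_trans (perm_to_rem pD')) //.
rewrite perm_cons perm_sym; apply: IHn => [|q /mem_rem/vD//|q /mem_rem/vD'//|s t st].
  by rewrite size_rem // -ltnS prednK // -has_predT; apply/hasP; exists p.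
have := eqc s t st.
by rewrite (rank_count_rem s t pD) (rank_count_rem s t pD') => /addnI.
Qed.

End Uniqueness.

Lemma is_barcode_unique (R : realType) (F : fieldType) (V : persistence_space R F)
    (D D' : diagram R) :
  is_barcode V D -> is_barcode V D' -> perm_eq D D'.
Proof.
move=> [vD isoD] [vD' isoD']; apply: diagram_eq_rank => // s t st.
apply: (@has_rank_unique _ _ V s t st).
  exact: has_rank_iso (pvs_iso_sym isoD) (has_rank_barcode F D st).
exact: has_rank_iso (pvs_iso_sym isoD') (has_rank_barcode F D' st).
Qed.

Lemma barcode_perm (R : realType) (F : fieldType) (V : persistence_space R F)
    (D : diagram R) :
  is_barcode V D -> perm_eq (barcode V) D.
Proof.
move=> VD; apply: (is_barcode_unique _ VD); rewrite /barcode.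
by apply: (@xgetPex _ [::] [set D | is_barcode V D]%classic); exists D.
Qed.

(** * Matchings between diagrams *)

Lemma perm_eq_mapP (T U : eqType) (h : T -> U) (s : seq U) (J : seq T) :
  perm_eq s (map h J) -> exists2 J', perm_eq J' J & s = map h J'.
Proof.
elim: s J => [|x s IHs] J.
  by case: J => [|y J]; [exists [::]|rewrite perm_sym => /perm_nilP].
move=> /[dup] /perm_mem/(_ x); rewrite mem_head => /esym/mapP[y yJ ->] hJ.
have yremJ := perm_to_rem yJ.
have [|J' J'J ->] := IHs (rem y J).
  by rewrite -(perm_cons (h y)) (perm_trans hJ) // (perm_map h yremJ).
by exists (y :: J') => //; rewrite perm_sym (perm_trans yremJ) // perm_cons perm_sym.
Qed.

Section Matching.
Variable R : realType.
Implicit Types (D : diagram R) (p q : R * \bar R) (eps : R).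

(** A matching given by common labels: points with the same label are matched,
    points whose label is not shared are left unmatched. *)
Lemma dD_le_indexed D D' eps (T : Type)
    (i1 : 'I_(size D) -> T) (i2 : 'I_(size D') -> T) :
  0 <= eps -> injective i1 -> injective i2 ->
  (forall i j, i1 i = i2 j ->
     (point_dist (tnth (in_tuple D) i) (tnth (in_tuple D') j) <= eps%:E)%E) ->
  (forall i, (forall j, i1 i <> i2 j) ->
     ((2^-1)%:E * pers (tnth (in_tuple D) i) <= eps%:E)%E) ->
  (forall j, (forall i, i1 i <> i2 j) ->
     ((2^-1)%:E * pers (tnth (in_tuple D') j) <= eps%:E)%E) ->
  (dD D D' <= eps%:E)%E.
Proof.
move=> eps0 inj1 inj2 dist12 pers1 pers2.
pose B1 := [set i | `[< exists j, i1 i = i2 j >]]%SET.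
pose B2 := [set j | `[< exists i, i1 i = i2 j >]]%SET.
have ephi (i : {i | i \in B1}) : exists j : {j | j \in B2}, i1 (val i) = i2 (val j).
  case: i => i /= /[dup] iB1; rewrite inE => /asboolP[j ij].
  have jB2 : j \in B2 by rewrite inE; apply/asboolP; exists i.
  by exists (exist _ j jB2).
have epsi (j : {j | j \in B2}) : exists i : {i | i \in B1}, i1 (val i) = i2 (val j).
  case: j => j /= /[dup] jB2; rewrite inE => /asboolP[i ij].
  have iB1 : i \in B1 by rewrite inE; apply/asboolP; exists j.
  by exists (exist _ i iB1).
have [phi phiP] := choice ephi.
have [psi psiP] := choice epsi.
have bij_phi : bijective phi.
  exists psi => x; apply: val_inj.
    by apply: inj1; rewrite psiP phiP.
  by apply: inj2; rewrite -phiP psiP.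
apply: (@le_trans _ _ (matching_cost phi)).
  by apply: ereal_inf_lbound; exists B1, B2, phi.
rewrite /matching_cost !ge_max.
apply/and3P; split; apply: bigmax_le; rewrite ?lee_fin //.
- by move=> i _; apply: dist12; rewrite phiP.
- move=> i; rewrite !inE => /asboolP nex; apply: pers1 => j ij.
  by apply: nex; exists j.
- move=> j; rewrite !inE => /asboolP nex; apply: pers2 => i ij.
  by apply: nex; exists i.
Qed.

(** Avoids extended arithmetic: for a finite eps, right ends are either both +oo
    or both real. *)
Definition near_point eps p q : Prop :=
  `|p.1 - q.1| <= eps /\
  match p.2, q.2 with
  | x%:E, y%:E => (`|x - y| <= eps)%R
  | +oo, +oo => True
  | _, _ => False
  end%E.

Definition off_diagonal p : bool := (p.1%:E < p.2)%E.

(** A matching as a list of pairs of possibly degenerate points: a point matched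
    with a degenerate one is unmatched in the sense of [matching_cost], being
    near the diagonal ([near_diagonal_pers]).  Degenerate points make matchings
    easy to compose and to read off a pairing of simplices. *)
Definition matched eps D D' : Prop :=
  exists L : seq ((R * \bar R) * (R * \bar R)),
  [/\ perm_eq D (seq.filter off_diagonal (map fst L)),
      perm_eq D' (seq.filter off_diagonal (map snd L))
    & forall pq, pq \in L -> near_point eps pq.1 pq.2].

Lemma near_point_sym eps p q : near_point eps p q -> near_point eps q p.
Proof.
move=> [h1 h2]; split; first by rewrite distrC.
by case: p.2 q.2 h2 => [x| |] [y| |] //; rewrite distrC.
Qed.

Lemma near_point_trans eps1 eps2 p q q' :
  near_point eps1 p q -> near_point eps2 q q' -> near_point (eps1 + eps2) p q'.
Proof.
move=> [h1 h2] [h3 h4]; split.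
  by rewrite (le_trans (ler_distD q.1 _ _)) // lerD.
case: p.2 q.2 q'.2 h2 h4 => [x| |] [y| |] [z| |] // h2 h4.
by rewrite (le_trans (ler_distD y _ _)) // lerD.
Qed.

Lemma near_point_dist eps p q : near_point eps p q -> (point_dist p q <= eps%:E)%E.
Proof.
move=> [h1 h2]; have eps0 := le_trans (normr_ge0 _) h1.
rewrite /point_dist ge_max /ext_dist; apply/andP; split.
  by case: ifP; rewrite lee_fin.
case: p.2 q.2 h2 => [x| |] [y| |] // h2.
by case: ifP; rewrite lee_fin.
Qed.

(** The ends of q are in the wrong order and each end of p is within eps of the
    corresponding end of q, so p has length at most 2 eps. *)
Lemma near_diagonal_pers eps p q : near_point eps p q -> ~~ off_diagonal q ->
  ((2^-1)%:E * pers p <= eps%:E)%E.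
Proof.
rewrite /off_diagonal /pers -leNgt => -[h1 h2].
case: p.2 q.2 h2 => [x| |] [y| |] // h2; rewrite !lee_fin => yq.
move: h1 h2; rewrite !ler_norml => /andP[? ?] /andP[? ?].
lra.
Qed.

Lemma matched_dD eps D D' : 0 <= eps -> matched eps D D' -> (dD D D' <= eps%:E)%E.
Proof.
move=> eps0 [L [DL D'L nearL]].
pose x0 : (R * \bar R) * (R * \bar R) := ((0, 0%E), (0, 0%E)).
pose h1 j := (nth x0 L j).1; pose h2 j := (nth x0 L j).2.
have index_map (g : (R * \bar R) * (R * \bar R) -> R * \bar R) :
    seq.filter off_diagonal (map g L) =
    map (fun j => g (nth x0 L j))
      [seq j <- iota 0 (size L) | off_diagonal (g (nth x0 L j))].
  by rewrite filter_map -{1}(mkseq_nth x0 L) filter_map -map_comp.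
(* J1 and J2 list the positions in L of the points of D and of D'. *)
have [J1 J1L def_D] := perm_eq_mapP (etrans (congr1 _ (esym (index_map fst))) DL).
have [J2 J2L def_D'] := perm_eq_mapP (etrans (congr1 _ (esym (index_map snd))) D'L).
have u1 : uniq J1 by rewrite (perm_uniq J1L) filter_uniq // iota_uniq.
have u2 : uniq J2 by rewrite (perm_uniq J2L) filter_uniq // iota_uniq.
have s1 : size J1 = size D by rewrite def_D size_map.
have s2 : size J2 = size D' by rewrite def_D' size_map.
have nth1 (i : 'I_(size D)) : tnth (in_tuple D) i = h1 (nth 0%N J1 i).
  have lt_i : (i < size J1)%N by rewrite s1.
  move: (nat_of_ord i) lt_i (tnth_nth x0.1 (in_tuple D) i) => j lt_j -> /=.
  by rewrite def_D (nth_map 0%N).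
have nth2 (i : 'I_(size D')) : tnth (in_tuple D') i = h2 (nth 0%N J2 i).
  have lt_i : (i < size J2)%N by rewrite s2.
  move: (nat_of_ord i) lt_i (tnth_nth x0.1 (in_tuple D') i) => j lt_j -> /=.
  by rewrite def_D' (nth_map 0%N).
have mem1 (i : 'I_(size D)) : nth 0%N J1 i \in J1 by rewrite mem_nth ?s1.
have mem2 (i : 'I_(size D')) : nth 0%N J2 i \in J2 by rewrite mem_nth ?s2.
have inJ1 j : (j \in J1) = off_diagonal (h1 j) && (j < size L)%N.
  by rewrite (perm_mem J1L) mem_filter mem_iota.
have inJ2 j : (j \in J2) = off_diagonal (h2 j) && (j < size L)%N.
  by rewrite (perm_mem J2L) mem_filter mem_iota.
have near_h j : (j < size L)%N -> near_point eps (h1 j) (h2 j).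
  by move=> jL; apply/nearL/mem_nth.
apply: (dD_le_indexed (i1 := fun i => nth 0%N J1 i)
  (i2 := fun i => nth 0%N J2 i)) => //.
- by move=> i i' /eqP; rewrite nth_uniq ?s1 // => /eqP /val_inj.
- by move=> i i' /eqP; rewrite nth_uniq ?s2 // => /eqP /val_inj.
- move=> i j ij; rewrite nth1 nth2 -ij; apply/near_point_dist/near_h.
  by have := mem1 i; rewrite inJ1 => /andP[].
- move=> i nij; rewrite nth1; have := mem1 i; rewrite inJ1 => /andP[_ iL].
  apply: near_diagonal_pers (near_h _ iL) _; apply/negP => off.
  have iJ2 : nth 0%N J1 i \in J2 by rewrite inJ2 off.
  have lt : (index (nth 0%N J1 i) J2 < size D')%N by rewrite -s2 index_mem.
  by apply: (nij (Ordinal lt)); rewrite /= nth_index.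
- move=> i nij; rewrite nth2; have := mem2 i; rewrite inJ2 => /andP[_ iL].
  apply: near_diagonal_pers (near_point_sym (near_h _ iL)) _; apply/negP => off.
  have iJ2 : nth 0%N J2 i \in J1 by rewrite inJ1 off.
  have lt : (index (nth 0%N J2 i) J1 < size D)%N by rewrite -s1 index_mem.
  by apply: (nij (Ordinal lt)); rewrite /= nth_index.
Qed.

Lemma near_point_mon eps eps' p q :
  eps <= eps' -> near_point eps p q -> near_point eps' p q.
Proof.
move=> le_eps [h1 h2]; split; first exact: le_trans h1 le_eps.
by case: p.2 q.2 h2 => [x| |] [y| |] // h2; apply: le_trans h2 le_eps.
Qed.

(** Pairs of the two lists are composed along the genuine points of D2.  Pairs
    whose end in D2 is degenerate are kept as they are, since that end is
    discarded from the outer diagrams too. *)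
Lemma matched_trans eps1 eps2 D1 D2 D3 : 0 <= eps1 -> 0 <= eps2 ->
  matched eps1 D1 D2 -> matched eps2 D2 D3 -> matched (eps1 + eps2) D1 D3.
Proof.
move=> e1 e2 [L [L1 L2 nearL]] [M [M2 M3 nearM]].
pose A := [seq x <- L | off_diagonal x.2]; pose B := [seq x <- L | ~~ off_diagonal x.2].
pose C := [seq x <- M | off_diagonal x.1]; pose E := [seq x <- M | ~~ off_diagonal x.1].
have AB : perm_eq L (A ++ B) by rewrite perm_sym perm_filterC.
have CE : perm_eq M (C ++ E) by rewrite perm_sym perm_filterC.
have AC : perm_eq (map snd A) (map fst C).
  by rewrite -!filter_map (perm_trans _ M2) // perm_sym.
have [C' C'C eAC] := perm_eq_mapP AC.
have sAC : size A = size C' by rewrite -(size_map snd) eAC size_map.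
have filter_off0 (g : (R * \bar R) * (R * \bar R) -> R * \bar R) N :
    seq.filter off_diagonal (map g [seq x <- N | ~~ off_diagonal (g x)]) = [::].
  by elim: N => //= x N IHN; case off: (off_diagonal (g x)) => //=; rewrite off.
exists (zip (map fst A) (map snd C') ++ B ++ E); split.
- rewrite !map_cat -/unzip1 unzip1_zip ?size_map ?sAC // !filter_cat filter_off0 cats0.
  by rewrite (perm_trans L1) // -filter_cat -map_cat; apply/perm_filter/perm_map.
- rewrite !map_cat -/unzip2 unzip2_zip ?size_map ?sAC // !filter_cat filter_off0 cat0s.
  rewrite (perm_trans M3) // -filter_cat -map_cat; apply/perm_filter/perm_map.
  by rewrite (perm_trans CE) // perm_cat2r perm_sym.
move=> x; rewrite !mem_cat => /or3P[|xB|xE].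
- pose x0 : (R * \bar R) * (R * \bar R) := ((0, 0%E), (0, 0%E)).
  move=> /(nthP (x0.1, x0.1))[i]; rewrite size_zip !size_map sAC minnn => iC <-.
  rewrite nth_zip ?size_map ?sAC //= !(nth_map x0) ?sAC //.
  apply: (@near_point_trans _ _ _ (nth x0 A i).2).
    apply: nearL; have : nth x0 A i \in A by rewrite mem_nth ?sAC.
    by rewrite mem_filter => /andP[].
  have -> : (nth x0 A i).2 = (nth x0 C' i).1.
    by rewrite -[LHS](nth_map _ x0.2) ?sAC // eAC (nth_map x0).
  apply: nearM; have : nth x0 C' i \in C' by rewrite mem_nth.
  by rewrite (perm_mem C'C) mem_filter => /andP[].
- apply: (@near_point_mon eps1); first by rewrite lerDl.
  by apply: nearL; move: xB; rewrite mem_filter => /andP[].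
- apply: (@near_point_mon eps2); first by rewrite lerDr.
  by apply: nearM; move: xE; rewrite mem_filter => /andP[].
Qed.

Lemma matched_perm eps D1 D1' D2 D2' : perm_eq D1 D1' -> perm_eq D2 D2' ->
  matched eps D1' D2' -> matched eps D1 D2.
Proof.
by move=> p1 p2 [L [L1 L2 nearL]]; exists L; rewrite (perm_trans p1) // (perm_trans p2).
Qed.

End Matching.

(** * Stability *)

Section Stability.
Variables (R : realType) (F : fieldType) (k : nat) (X : finType).
Hypothesis X_gt0 : (0 < #|X|)%N.
Implicit Types (f g h : pow X -> R) (eps : R) (x y : pow X).

Definition monotone_filt f : Prop :=
  forall s t : pow X, val t \subset val s -> f t <= f s.

Definition diagram_of f (fm : monotone_filt f) : diagram R :=
  Dk F k (FilteredSpace X_gt0 fm).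

Lemma exists_ranking h : exists r : pow X -> nat,
  injective r /\ forall x y, (r x <= r y)%N -> h x <= h y.
Proof.
pose s := sort (relpre h <=%R) (enum {: pow X}).
have mem_s x : x \in s by rewrite mem_sort mem_enum.
exists (fun x => index x s); split=> [x y|x y le_xy].
  exact: (index_inj x (mem_s x) (mem_s y)).
have le_tr : transitive (relpre h <=%R) by move=> ? ? ?; apply: le_trans.
have le_refl : reflexive (relpre h <=%R) by move=> ?; apply: lexx.
have le_tot : total (relpre h <=%R) by move=> ? ?; apply: le_total.
by apply: (sorted_leq_index le_tr le_refl (sort_sorted le_tot _)) le_xy; apply: mem_s.
Qed.

Lemma near_pairing_point (b : pow X -> option (pow X)) f g eps x :
  (forall y, `|f y - g y| <= eps) ->
  near_point eps (pairing_point b f x) (pairing_point b g x).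
Proof.
by move=> fg; split; rewrite /pairing_point //= /death; case: pickP => [y _|].
Qed.

(** With no strict disagreement between f and g, the order of f + g is compatible
    with both, and a single pairing computes both diagrams. *)
Lemma matched_uncrossed f g (fm : monotone_filt f) (gm : monotone_filt g) eps :
  (forall x y, 0 <= (f x - f y) * (g x - g y)) ->
  (forall x, `|f x - g x| <= eps) ->
  matched eps (diagram_of fm) (diagram_of gm).
Proof.
move=> fg_mono fg.
have [r [r_inj r_sum]] := exists_ranking (fun x => f x + g x).
have r_f x y : (r x <= r y)%N -> f x <= f y.
  move=> /r_sum h; have := fg_mono x y; rewrite leNgt; apply: contraNle => lt_yx.
  nra.
have r_g x y : (r x <= r y)%N -> g x <= g y.
  move=> /r_sum h; have := fg_mono x y; rewrite leNgt; apply: contraNle => lt_yx.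
  nra.
have [e [b eb]] := exists_adapted_basis F r_inj.
have bar_f := persistent_homology_barcode k (X := FilteredSpace X_gt0 fm) r_inj r_f eb.
have bar_g := persistent_homology_barcode k (X := FilteredSpace X_gt0 gm) r_inj r_g eb.
apply: matched_perm (barcode_perm bar_f) (barcode_perm bar_g) _.
exists [seq (pairing_point b f x, pairing_point b g x) | x <- births b k]; split.
- by rewrite -map_comp.
- by rewrite -map_comp.
by move=> _ /mapP[x _ ->]; apply: near_pairing_point.
Qed.

(** Pairs of simplices entering in opposite orders in the two filtrations. *)
Definition inversions f g : {set pow X * pow X} :=
  [set p | (f p.1 - f p.2) * (g p.1 - g p.2) < 0]%SET.

Lemma monotone_mix f g (c : R) :
  0 <= c <= 1 -> monotone_filt f -> monotone_filt g ->
  monotone_filt (fun x => (1 - c) * f x + c * g x).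
Proof.
move=> /andP[c0 c1] fm gm s t ts; apply: lerD; apply: ler_wpM2l => //.
- by rewrite subr_ge0.
- exact: fm.
- exact: gm.
Qed.

(** Here A and B are the differences of f and of g on a pair of simplices: a pair
    inverted between f and (1 - c) f + c g is inverted between f and g. *)
Lemma mix_neg (c A B : R) :
  0 < c < 1 -> A * ((1 - c) * A + c * B) < 0 -> A * B < 0.
Proof.
move=> /andP[c0 c1] neg; rewrite ltNge; apply/negP => AB.
have sq : 0 <= (1 - c) * (A * A).
  by rewrite mulr_ge0 ?subr_ge0 ?(ltW c1) // -expr2 sqr_ge0.
have mix : 0 <= c * (A * B) by rewrite mulr_ge0 // ltW.
by move: neg; rewrite ltNge => /negP; apply; lra.
Qed.

(** By induction on the number of inversions: cutting the segment from f to g at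
    the crossing of one inverted pair removes this pair from both halves and
    creates no new one. *)
Lemma stability f g (fm : monotone_filt f) (gm : monotone_filt g) eps :
  (forall x, `|f x - g x| <= eps) -> matched eps (diagram_of fm) (diagram_of gm).
Proof.
have [n] := ubnP #|inversions f g|; elim: n f g fm gm eps => // n IHn f g fm gm eps.
rewrite ltnS => size_n fg.
have [inv0|[[x y]]] := set_0Vmem (inversions f g).
  apply: matched_uncrossed => // x y; rewrite leNgt; apply/negP => xy.
  have : (x, y) \notin inversions f g by rewrite inv0 finset.in_set0.
  by rewrite inE /= xy.
rewrite inE /=; set u := f x - f y; set v := g x - g y => uv.
have uv0 : u - v != 0 by apply: contraTneq uv => uv0; rewrite -leNgt; nra.
(* The parameter at which the values on x and y cross. *)
pose c := u / (u - v).
have c_root : (1 - c) * u + c * v = 0 by rewrite /c; field.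
have c01 : 0 < c < 1.
  have cuv : c * (u - v) = u by rewrite /c divfK.
  by apply/andP; split; nra.
have [c0 c1] := andP c01.
have c01' : 0 <= c <= 1 by rewrite !ltW.
pose h x := (1 - c) * f x + c * g x.
have hm : monotone_filt h := monotone_mix c01' fm gm.
have eps0 : 0 <= eps := le_trans (normr_ge0 _) (fg x).
have -> : eps = c * eps + (1 - c) * eps by ring.
have hE a b : h a - h b = (1 - c) * (f a - f b) + c * (g a - g b) by rewrite /h; ring.
have xy_inv : (x, y) \in inversions f g by rewrite inE.
have hxy : h x - h y = 0 by rewrite hE.
apply: (@matched_trans _ _ _ _ (diagram_of hm)).
- exact: mulr_ge0 (ltW c0) eps0.
- by rewrite mulr_ge0 // subr_ge0 ltW.
- apply: IHn => [|z]; last first.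
    have -> : f z - h z = c * (f z - g z) by rewrite /h; ring.
    by rewrite normrM (ger0_norm (ltW c0)); apply: (ler_wpM2l (ltW c0)).
  apply: leq_trans size_n; apply: proper_card; apply/properP; split.
    by apply/fintype.subsetP => -[a b]; rewrite !inE /= hE; apply: mix_neg c01.
  by exists (x, y) => //; rewrite inE /= hxy mulr0 ltxx.
apply: IHn => [|z]; last first.
  have -> : h z - g z = (1 - c) * (f z - g z) by rewrite /h; ring.
  have c1' : 0 <= 1 - c by rewrite subr_ge0 ltW.
  by rewrite normrM (ger0_norm c1'); apply: ler_wpM2l.
apply: leq_trans size_n; apply: proper_card; apply/properP; split.
  apply/fintype.subsetP => -[a b]; rewrite !inE /= hE => neg.
  rewrite mulrC; apply: (@mix_neg (1 - c)); first by rewrite subr_gt0 c1 ltrBlDr ltrDl.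
  by rewrite mulrC opprB addrCA subrr addr0 addrC.
by exists (x, y) => //; rewrite inE /= hxy mul0r ltxx.
Qed.

End Stability.

(** * Length of the curve of diagrams *)

Lemma distortion_ge (R : realType) (X Y : filtered_space R) (T : tripod X Y)
    (s : pow T) :
  `|pullback (projX T) s - pullback (projY T) s| <= distortion T.
Proof. exact: le_bigmax. Qed.

Lemma dD_gammaT_le (R : realType) (F : fieldType) (X Y : filtered_space R) k
    (T : tripod X Y) (s t : {i01 R}) : s%:num <= t%:num ->
  (dD (Dk F k (gammaT T s)) (Dk F k (gammaT T t))
     <= ((t%:num - s%:num) * distortion T)%:E)%E.
Proof.
move=> st; apply: matched_dD.
  apply: mulr_ge0; first by rewrite subr_ge0.
  exact: bigmax_ge_id.
apply: stability => u.
have -> : filt_interp s u - filt_interp t u =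
   (t%:num - s%:num) * (pullback (projX T) u - pullback (projY T) u).
  by rewrite /filt_interp; ring.
rewrite normrM ger0_norm ?subr_ge0 //; apply: ler_wpM2l; first by rewrite subr_ge0.
exact: distortion_ge.
Qed.

Theorem theorem6p2 (R : realType) (F : fieldType) (X Y : filtered_space R)
    (k : nat) :
  (ereal_sup [set l | exists2 T : tripod X Y, Topt T &
                     l = LD (fun t => Dk F k (gammaT T t))]%classic
     <= (dF X Y)%:E)%E.
Proof.
apply: ge_ereal_sup => _ [T <- ->].
apply: ge_ereal_sup => _ [n [t [_ t0 tn lt_t ->]]].
have -> : distortion T =
    \sum_(0 <= i < n) ((t i.+1)%:num - (t i)%:num) * distortion T.
  by rewrite -mulr_suml telescope_sumr // tn t0 subr0 mul1r.
rewrite -sumEFin big_nat [leRHS]big_nat.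
apply: lee_sum => i /andP[_ lt_in].
by apply: dD_gammaT_le; apply/ltW/lt_t.
Qed.
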